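(* Let $n\ge1$, let $V=\mathbb{C}^n$ be the standard $\mathrm{GL}(n,\mathbb{C})$-module and let $W=\Lambda(S^2V)$. Then $$H(W^{\mathrm{O}(n)},t)=1+t+\sum_{\substack{p=2\\ p\text{ even}}}^{n}t^{\frac{p(p+1)}{2}}\left(\sum_{\substack{a_1+\cdots+a_{p/2}\le n-p\\ a_1,\ldots,a_{(p-2)/2}\text{ even},\ a_{p/2}\text{ odd}}}t^{2a_1+4a_2+\cdots+p\,a_{p/2}}\right)+\sum_{\substack{p=3\\ p\text{ odd}}}^{n}t^{\frac{p(p+1)}{2}}\left(\sum_{\substack{a_1+\cdots+a_{(p-1)/2}\le n-p\\ a_i\text{ even}}}t^{2a_1+4a_2+\cdots+(p-1)a_{(p-1)/2}}\right),$$ where the inner sums run over tuples of non-negative integers $a_i$ satisfying the indicated conditions.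
   Context: $S^2V$ is the second symmetric power of $V$. $\Lambda(S^2V)=\bigoplus_{i\ge0}\Lambda^i(S^2V)$ is the exterior algebra of $S^2V$, with the induced action of $\mathrm{GL}(n,\mathbb{C})$ and hence of the complex orthogonal group $\mathrm{O}(n)$. The Hilbert series is $H(\Lambda(S^2V)^{G},t)=\sum_{i\ge0}\dim\bigl(\Lambda^i(S^2V)^{G}\bigr)t^i$. Empty sums are $0$. *)

(* Defs.v *)
From HB Require Import structures.
From mathcomp Require Import all_boot all_order all_algebra all_fingroup.
From mathcomp Require Import boolp classical_sets reals.
From mathcomp Require Import complex zify.

Set Implicit Arguments.
Unset Strict Implicit.
Unset Printing Implicit Defensive.

Import Order.TTheory GRing.Theory Num.Theory.
Local Open Scope ring_scope.

Lemma linear_expand (K : pzRingType) (U F : lmodType K) (h : U -> F)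
    (I : finType) (c : I -> K) (x : I -> U) :
  linear h -> h (\sum_i c i *: x i) = \sum_i c i *: h (x i).
Proof.
move=> hL; pose H : {linear U -> F} := HB.pack h (GRing.isLinear.Build K U F _ h hL).
rewrite -[h]/(H : U -> F) linear_sum /=.
by apply: eq_bigr => i _; rewrite -[h]/(H : U -> F) linearZ.
Qed.

Section Coordinates.
Variables (K : fieldType) (U : vectType K).

Definition basis_vec (a : 'I_(\dim {:U})) : U := (vbasis {:U})`_a.

Definition cd (a : 'I_(\dim {:U})) (u : U) : K := coord (vbasis {:U}) a u.

Lemma cd_expand (u : U) : u = \sum_a cd a u *: basis_vec a.
Proof. exact: coord_vbasis (memvf u). Qed.

Lemma cd_basis a b : cd a (basis_vec b) = (a == b)%:R.
Proof. by rewrite /cd /basis_vec coord_free ?(basis_free (vbasisP _)) // eq_sym. Qed.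

Lemma cd_linear a c u v : cd a (c *: u + v) = c * cd a u + cd a v.
Proof. by rewrite /cd linearP. Qed.

End Coordinates.

(* S^2 U has basis the symbols e_a e_b with a <= b, where (e_a) is the basis
   [vbasis {:U}] of U; [sprod u v] is the product u v.  Universal property:
   [sym2_ext_sprod] and [sym2_ext_unique]. *)
Section Sym2.
Variable K : fieldType.

Definition sym_index (m : nat) := {p : 'I_m * 'I_m | (p.1 <= p.2)%N}.

Definition sym2 (U : vectType K) : vectType K :=
  {ffun sym_index (\dim {:U}) -> K^o}.

Definition sprod (U : vectType K) (u v : U) : sym2 U :=
  [ffun p => let a := (val p).1 in let b := (val p).2 in
     if a == b then cd a u * cd a v
     else cd a u * cd b v + cd b u * cd a v].

Definition sym2_ext (U : vectType K) (F : lmodType K) (f : U -> U -> F)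
    (w : sym2 U) : F :=
  \sum_p w p *: f (basis_vec (val p).1) (basis_vec (val p).2).

Definition sym2_map (U U' : vectType K) (f : 'Hom(U, U')) :
    'Hom(sym2 U, sym2 U') :=
  linfun (sym2_ext (fun u v => sprod (f u) (f v))).

End Sym2.

Section Sym2Theory.
Variable K : fieldType.
Implicit Types (U : vectType K) (F : lmodType K).

Lemma sprodC U (u v : U) : sprod u v = sprod v u.
Proof.
by apply/ffunP => p; rewrite !ffunE /=; case: ifP => _;
  rewrite 1?addrC ![cd _ u * _]mulrC.
Qed.

Lemma sprod_linear U c (u u' v : U) :
  sprod (c *: u + u') v = c *: sprod u v + sprod u' v.
Proof.
apply/ffunP => p; rewrite !ffunE /= !cd_linear /GRing.scale /=.
by case: ifP => _; rewrite !mulrDl ?mulrDr -!mulrA //; rewrite addrACA.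
Qed.

Lemma sprod_basis U (p : sym_index (\dim {:U})) :
  sprod (basis_vec (val p).1) (basis_vec (val p).2)
    = [ffun q => (q == p)%:R].
Proof.
apply/ffunP => q; rewrite !ffunE /= !cd_basis.
have -> : (q == p) = ((val q).1 == (val p).1) && ((val q).2 == (val p).2).
  by rewrite -val_eqE; case: (val q) (val p) => [? ?] [? ?]; rewrite xpair_eqE.
case: p q => [[a b] /= ab] [[a' b'] /= ab'].
move: ab ab'; case: (ltngtP a b) => // [ab|/val_inj ab] _;
  case: (ltngtP a' b') => // [ab'|/val_inj ab'] _; rewrite -?val_eqE /=.
- rewrite ltn_eqF //.
  case: eqP => [e1|_]; case: eqP => [e2|_];
  case: eqP => [e3|_]; case: eqP => [e4|_]; rewrite ?mul1r ?mul0r ?addr0 //;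
  lia.
- subst; rewrite eqxx.
  case: eqP => [e1|_]; case: eqP => [e2|_]; rewrite ?mul1r ?mul0r ?addr0 //; lia.
- subst; rewrite ltn_eqF //.
  case: eqP => [e1|_]; case: eqP => [e2|_]; rewrite ?mul1r ?mul0r ?addr0 //; lia.
- subst; rewrite eqxx.
  by case: eqP => _; rewrite ?mul1r ?mul0r.
Qed.

Lemma sym2_ext_is_linear U F (f : U -> U -> F) : linear (sym2_ext f).
Proof.
move=> c w w'; rewrite /sym2_ext scaler_sumr -big_split /=.
by apply: eq_bigr => p _; rewrite !ffunE scalerA -scalerDl.
Qed.

HB.instance Definition _ U F (f : U -> U -> F) :=
  GRing.isLinear.Build K (sym2 U) F _ (sym2_ext f) (sym2_ext_is_linear f).

Lemma sym2_expand U (w : sym2 U) :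
  w = \sum_p w p *: sprod (basis_vec (val p).1) (basis_vec (val p).2).
Proof.
apply/ffunP => q; rewrite sum_ffunE (bigD1 q) //= big1 ?addr0 => [|p pq].
  by rewrite sprod_basis !ffunE eqxx /GRing.scale /= mulr1.
by rewrite sprod_basis !ffunE eq_sym (negPf pq) /GRing.scale /= mulr0.
Qed.

Lemma sym2_ext_sprod U F (f : U -> U -> F)
    (fC : forall u v, f u v = f v u)
    (fL : forall c u u' v, f (c *: u + u') v = c *: f u v + f u' v) u v :
  sym2_ext f (sprod u v) = f u v.
Proof.
have basis_case (p : sym_index (\dim {:U})) :
    sym2_ext f (sprod (basis_vec (val p).1) (basis_vec (val p).2))
    = f (basis_vec (val p).1) (basis_vec (val p).2).
  rewrite sprod_basis /sym2_ext (bigD1 p) //= big1 ?addr0 => [|q qp].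
    by rewrite ffunE eqxx scale1r.
  by rewrite ffunE (negPf qp) scale0r.
have basis2 a b : sym2_ext f (sprod (basis_vec a) (basis_vec b))
    = f (basis_vec a) (basis_vec b).
  case: (leqP a b) => [ab|/ltnW ab]; first exact: (basis_case (exist _ (a, b) ab)).
  by rewrite sprodC fC; exact: (basis_case (exist _ (b, a) ab)).
have gL v0 : linear (fun u0 => sym2_ext f (sprod u0 v0)).
  by move=> c x y; rewrite sprod_linear linearP.
have fL' v0 : linear (f^~ v0) by move=> c x y; apply: fL.
rewrite [u]cd_expand (linear_expand _ _ (gL v)) (linear_expand _ _ (fL' v)).
apply: eq_bigr => a _; congr (_ *: _).
rewrite sprodC fC [v]cd_expand (linear_expand _ _ (gL _)) (linear_expand _ _ (fL' _)).
by apply: eq_bigr => b _; rewrite basis2.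
Qed.

Lemma sym2_ext_unique U F (f : U -> U -> F) (g : {linear sym2 U -> F}) :
  (forall u v, g (sprod u v) = f u v) -> g =1 sym2_ext f.
Proof.
move=> gf w; rewrite [w in LHS]sym2_expand linear_sum /=.
by apply: eq_bigr => p _; rewrite linearZ gf.
Qed.

Lemma sym2_map_sprod (U U' : vectType K) (f : 'Hom(U, U')) (u v : U) :
  sym2_map f (sprod u v) = sprod (f u) (f v).
Proof.
rewrite lfunE /= sym2_ext_sprod // => [x y|c x x' y]; first exact: sprodC.
by rewrite linearP sprod_linear.
Qed.

End Sym2Theory.

(* Lambda^k U has basis the symbols e_{s 0} /\ ... /\ e_{s (k-1)} for
   s : 'I_k -> 'I_(\dim {:U}) strictly increasing; by multilinearity the
   coordinates of u_0 /\ ... /\ u_{k-1} are the k x k minors of the coordinates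
   of the u_a.  Universal property: [ext_ext_wedge] and [ext_ext_unique]. *)
Section Ext.
Variable K : fieldType.

Definition increasing k m (s : {ffun 'I_k -> 'I_m}) :=
  [forall a : 'I_k, forall b : 'I_k, (a < b)%N ==> (s a < s b)%N].

Definition ext_index k m := {s : {ffun 'I_k -> 'I_m} | increasing s}.

Definition ext_pow k (U : vectType K) : vectType K :=
  {ffun ext_index k (\dim {:U}) -> K^o}.

Definition wedge k (U : vectType K) (u : {ffun 'I_k -> U}) : ext_pow k U :=
  [ffun s : ext_index k (\dim {:U}) =>
     \det (\matrix_(a, b) cd (val s b) (u a))].

Definition ext_ext k (U : vectType K) (F : lmodType K)
    (f : {ffun 'I_k -> U} -> F) (w : ext_pow k U) : F :=
  \sum_s w s *: f [ffun a => basis_vec (val s a)].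

Definition ext_map k (U U' : vectType K) (f : 'Hom(U, U')) :
    'Hom(ext_pow k U, ext_pow k U') :=
  linfun (ext_ext (fun u => wedge [ffun a => f (u a)])).

Definition update k (U : Type) (u : {ffun 'I_k -> U}) (i : 'I_k) (x : U) :
  {ffun 'I_k -> U} := [ffun j => if j == i then x else u j].

Definition multilinear k (U F : lmodType K) (f : {ffun 'I_k -> U} -> F) :=
  forall (u : {ffun 'I_k -> U}) i, linear (fun x => f (update u i x)).

Definition alternating k (U F : lmodType K) (f : {ffun 'I_k -> U} -> F) :=
  forall (u : {ffun 'I_k -> U}) i j, i != j -> u i = u j -> f u = 0.

End Ext.

Section ExtTheory.
Variables (K : fieldType) (k : nat).
Implicit Types (U : vectType K) (F : lmodType K).

Lemma update_id (U : Type) (u : {ffun 'I_k -> U}) i : update u i (u i) = u.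
Proof. by apply/ffunP => j; rewrite ffunE; case: eqP => [->|]. Qed.

Lemma wedge_multilinear U : multilinear (@wedge K k U).
Proof.
move=> u i c x y; apply/ffunP => s; rewrite !ffunE.
rewrite -[X in _ = _ + X]mul1r; apply: (determinant_multilinear (i0 := i)).
- by apply/rowP => b; rewrite !mxE !ffunE eqxx cd_linear mul1r.
- by apply/matrixP => a b; rewrite !mxE !ffunE eq_sym (negPf (neq_lift _ _)).
- by apply/matrixP => a b; rewrite !mxE !ffunE eq_sym (negPf (neq_lift _ _)).
Qed.

Lemma wedge_alternating U : alternating (@wedge K k U).
Proof.
move=> u i j ij uij; apply/ffunP => s; rewrite !ffunE.
by apply: (determinant_alternate ij) => b; rewrite !mxE uij.
Qed.

Lemma update_same (U : Type) (u : {ffun 'I_k -> U}) i x y :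
  update (update u i x) i y = update u i y.
Proof. by apply/ffunP => j; rewrite !ffunE; case: eqP. Qed.

Lemma updateC (U : Type) (u : {ffun 'I_k -> U}) i j x y : i != j ->
  update (update u i x) j y = update (update u j y) i x.
Proof.
move=> ij; apply/ffunP => a; rewrite !ffunE.
by case: eqP => // ->; rewrite eq_sym (negPf ij).
Qed.

Section Vanishing.
Variables (U : vectType K) (F : lmodType K) (G : {ffun 'I_k -> U} -> F).
Hypothesis (GM : multilinear G).

Lemma multilinear_eq0 :
  (forall t : {ffun 'I_k -> 'I_(\dim {:U})}, G [ffun a => basis_vec (t a)] = 0) ->
  forall u : {ffun 'I_k -> U}, G u = 0.
Proof.
move=> G0; have step i : (i <= k)%N -> forall u : {ffun 'I_k -> U},
    (forall a : 'I_k, (i <= a)%N -> exists b, u a = basis_vec b) -> G u = 0.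
  elim: i => [_ u ub|i IH ik u ub].
    have /fin_all_exists [t ut] (a : 'I_k) : exists b, u a = basis_vec b by exact: ub.
    rewrite -[RHS](G0 [ffun a => t a]); congr G.
    by apply/ffunP => a; rewrite !ffunE ut.
  pose j := Ordinal ik.
  rewrite -(update_id u j) [u j]cd_expand (linear_expand _ _ (GM u j)).
  rewrite big1 // => b _; rewrite IH ?scaler0 // => [|a ia]; first exact: ltnW.
  rewrite ffunE; case: eqP => [_|/eqP aj]; first by exists b.
  by apply: ub; rewrite ltn_neqAle ia andbT; move: aj; rewrite -val_eqE eq_sym.
by move=> u; apply: (step k) => // a; rewrite leqNgt ltn_ord.
Qed.

Hypothesis (GA : alternating G).

Lemma alternating_swap (u : {ffun 'I_k -> U}) i j :
  i != j -> G [ffun a => u (tperm i j a)] = - G u.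
Proof.
move=> ij; pose H x y := G (update (update u i x) j y).
have HD y x x' : H (x + x') y = H x y + H x' y.
  by rewrite /H !(updateC u _ y ij) -[x]scale1r (GM (update u j y) i 1) !scale1r.
have HD' y x x' : H y (x + x') = H y x + H y x'.
  by rewrite /H -[x]scale1r (GM (update u i y) j 1) !scale1r.
have H0 x : H x x = 0.
  by apply: (GA ij); rewrite !ffunE eqxx (negPf ij) eqxx.
have := H0 (u i + u j); rewrite HD !HD' !H0 add0r addr0 => /eqP.
rewrite addrC addr_eq0 => /eqP.
have -> : H (u i) (u j) = G u.
  by rewrite /H (update_id u i) (update_id u j).
move=> <-; congr G; apply/ffunP => a; rewrite !ffunE.
case: tpermP => [->|->|/eqP ai /eqP aj].
- by rewrite (negPf ij) eqxx.
- by rewrite eqxx.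
- by rewrite (negPf ai) (negPf aj).
Qed.

Lemma alternating_perm_eq0 (p : 'S_k) (u : {ffun 'I_k -> U}) :
  G u = 0 -> G [ffun a => u (p a)] = 0.
Proof.
have [ts -> tsd] := prod_tpermP p; elim: ts tsd u => [_ u <-|[i j] ts IH].
  by rewrite big_nil; congr G; apply/ffunP => a; rewrite ffunE perm1.
move=> /= /andP[ij tsd] u Gu; rewrite big_cons /=.
set q := (\prod_(t <- ts) _)%g.
have -> : [ffun a => u ((tperm i j * q)%g a)]
    = [ffun a => [ffun b => u (q b)] (tperm i j a)].
  by apply/ffunP => a; rewrite !ffunE permM.
by rewrite alternating_swap // IH ?oppr0.
Qed.

Lemma alternating_eq0 :
  (forall s : ext_index k (\dim {:U}), G [ffun a => basis_vec (val s a)] = 0) ->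
  forall u : {ffun 'I_k -> U}, G u = 0.
Proof.
move=> G0; apply: multilinear_eq0 => t.
case: (boolP (injectiveb t)) => [/injectiveP tI|/injectivePn[i [j ij tij]]]; last first.
  by apply: (GA ij); rewrite !ffunE tij.
pose T := [tuple t a | a < k].
pose S := sort_tuple (relpre val leq) T.
have /tuple_permP[p Tp] : perm_eq T S by rewrite perm_sym perm_sort.
have tp a : t a = tnth S (p a).
  by have := congr1 (nth (t a) ^~ a) Tp; rewrite !nth_mktuple.
have SU : sorted ltn (map val S).
  rewrite ltn_sorted_uniq_leq map_inj_uniq; last exact: val_inj.
  rewrite sort_uniq map_inj_uniq // enum_uniq /=.
  by rewrite sorted_map; apply: sort_sorted => x y /=; apply: leq_total.
have Sinc : increasing [ffun a => tnth S a].
  apply/forallP => a; apply/forallP => b; apply/implyP => ab; rewrite !ffunE.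
  have := sorted_ltn_nth ltn_trans 0%N SU; move/(_ a b).
  by rewrite !inE size_map size_tuple !ltn_ord !(nth_map (t a)) ?size_tuple //
     !(tnth_nth (t a)); apply.
pose s : ext_index k (\dim {:U}) := exist _ [ffun a => tnth S a] Sinc.
have E := alternating_perm_eq0 p (G0 s).
by rewrite -[RHS]E; congr G; apply/ffunP => a; rewrite !ffunE tp.
Qed.

End Vanishing.

Lemma increasing_sorted m (s : {ffun 'I_k -> 'I_m}) :
  increasing s -> sorted ltn [seq val (s a) | a <- enum 'I_k].
Proof.
move=> sI; have : sorted (relpre val ltn) (enum 'I_k).
  by rewrite -sorted_map val_enum_ord iota_ltn_sorted.
apply: (homo_sorted (f := fun a => val (s a))) => a b /= ab.
exact: (implyP (forallP (forallP sI a) b)).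
Qed.

Lemma increasing_inj m (s : {ffun 'I_k -> 'I_m}) : increasing s -> injective s.
Proof.
move=> sI a b e; case: (ltngtP a b) => [ab|ba|/val_inj //].
- by have := implyP (forallP (forallP sI a) b) ab; rewrite e ltnn.
- by have := implyP (forallP (forallP sI b) a) ba; rewrite e ltnn.
Qed.

Lemma increasing_eq m (s q : {ffun 'I_k -> 'I_m}) :
  increasing s -> increasing q -> (forall a, exists b, s a = q b) -> s = q.
Proof.
move=> sI qI sub.
have e : [seq val (s a) | a <- enum 'I_k] = [seq val (q a) | a <- enum 'I_k].
  apply: (irr_sorted_eq ltn_trans ltnn (increasing_sorted sI) (increasing_sorted qI)).
  apply: (uniq_min_size (s1 := [seq val (s a) | a <- enum 'I_k]) _ _ _).2.
  - by rewrite map_inj_uniq ?enum_uniq // => a b /val_inj /(increasing_inj sI).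
  - move=> _ /mapP[a _ ->]; have [b ->] := sub a.
    by apply: map_f; rewrite mem_enum.
  - by rewrite !size_map.
move/eq_in_map: e => e; apply/ffunP => a; apply/val_inj/e.
by rewrite mem_enum.
Qed.

Lemma wedge_basis U (s : ext_index k (\dim {:U})) :
  wedge [ffun a => basis_vec (val s a)] = [ffun q => (q == s)%:R].
Proof.
apply/ffunP => q; rewrite !ffunE; case: (eqVneq q s) => [->|qs].
  rewrite -[RHS](det1 K k); congr (\det _); apply/matrixP => a b.
  rewrite !mxE ffunE cd_basis (inj_eq (increasing_inj (valP s))).
  by rewrite eq_sym.
have [a na] : exists a, forall b, val q b != val s a.
  apply: contrapT => nE; case/eqP: qs; apply/val_inj; apply/esym.
  apply: increasing_eq (valP s) (valP q) _ => a.
  apply: contrapT => na; apply: nE; exists a => b.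
  by apply/negP => /eqP e; apply: na; exists b.
rewrite (expand_det_row _ a) big1 // => b _.
by rewrite !mxE ffunE cd_basis (negPf (na b)) mul0r.
Qed.

Lemma ext_ext_is_linear U F (f : {ffun 'I_k -> U} -> F) : linear (ext_ext f).
Proof.
move=> c w w'; rewrite /ext_ext scaler_sumr -big_split /=.
by apply: eq_bigr => p _; rewrite !ffunE scalerA -scalerDl.
Qed.

HB.instance Definition _ U F (f : {ffun 'I_k -> U} -> F) :=
  GRing.isLinear.Build K (ext_pow k U) F _ (ext_ext f) (ext_ext_is_linear f).

Lemma ext_expand U (w : ext_pow k U) :
  w = \sum_s w s *: wedge [ffun a => basis_vec (val s a)].
Proof.
apply/ffunP => q; rewrite sum_ffunE (bigD1 q) //= big1 ?addr0 => [|s sq].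
  by rewrite wedge_basis !ffunE eqxx /GRing.scale /= mulr1.
by rewrite wedge_basis !ffunE eq_sym (negPf sq) /GRing.scale /= mulr0.
Qed.

Lemma ext_ext_wedge U F (f : {ffun 'I_k -> U} -> F) (u : {ffun 'I_k -> U}) :
  multilinear f -> alternating f -> ext_ext f (wedge u) = f u.
Proof.
move=> fM fA; apply/eqP; rewrite -subr_eq0; apply/eqP.
apply: (alternating_eq0 (G := fun u => ext_ext f (wedge u) - f u)).
- move=> v i c x y; rewrite wedge_multilinear linearP fM scalerBr.
  by rewrite opprD addrACA.
- by move=> v i j ij vij; rewrite (wedge_alternating ij vij) (fA _ _ _ ij vij)
    linear0 subr0.
move=> s; rewrite wedge_basis /ext_ext (bigD1 s) //= big1 ?addr0 => [|q qs].
  by rewrite ffunE eqxx scale1r subrr.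
by rewrite ffunE (negPf qs) scale0r.
Qed.

Lemma ext_ext_unique U F (f : {ffun 'I_k -> U} -> F)
    (g : {linear ext_pow k U -> F}) :
  (forall u, g (wedge u) = f u) -> g =1 ext_ext f.
Proof.
move=> gf w; rewrite [w in LHS]ext_expand linear_sum /=.
by apply: eq_bigr => p _; rewrite linearZ gf.
Qed.

Lemma ext_map_wedge (U U' : vectType K) (f : 'Hom(U, U')) (u : {ffun 'I_k -> U}) :
  ext_map k f (wedge u) = wedge [ffun a => f (u a)].
Proof.
rewrite lfunE /= ext_ext_wedge //.
- have upd (v : {ffun 'I_k -> U}) i x :
    [ffun a => f (update v i x a)] = update [ffun a => f (v a)] i (f x).
    by apply/ffunP => a; rewrite !ffunE; case: eqP.
  by move=> v i c x y; rewrite !upd linearP wedge_multilinear.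
- by move=> v i j ij vij; apply: (wedge_alternating ij); rewrite !ffunE vij.
Qed.

End ExtTheory.

Section Invariants.
Variables (K : fieldType) (E : vectType K) (T : Type).
Implicit Types (G : set T) (act : T -> 'End(E)).

Definition invariants G act : {vspace E} :=
  xget 0%VS [set U : {vspace E} |
    forall w, w \in U <-> forall g, G g -> act g w = w].

Lemma mem_invariants G act w :
  w \in invariants G act <-> forall g, G g -> act g w = w.
Proof.
pose P w := forall g, G g -> act g w = w.
pose D d := `[< exists U : {vspace E}, {subset U <= [pred w | `[< P w >]]}
  /\ \dim U = d >].
suff : exists U : {vspace E}, forall w, w \in U <-> P w by move/(xgetPex 0%VS); apply.
have Dex : exists d, D d.
  exists 0%N; apply/asboolP; exists 0%VS; split; last exact: dimv0.
  by move=> v; rewrite memv0 => /eqP ->; apply/asboolP => g _; rewrite linear0.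
have Dub d : D d -> (d <= \dim {:E})%N.
  by move/asboolP => [U [_ <-]]; apply/dimvS/subvf.
case: (ex_maxnP Dex Dub) => d /asboolP[U [UP dU]] dmax; exists U => v; split.
  by move/UP/asboolP.
move=> Pv; apply: contrapT => nvU.
have /dmax : D (\dim (U + <[v]>)%VS).
  apply/asboolP; exists (U + <[v]>)%VS; split => // x /memv_addP[y yU [_ /vlineP[c ->] ->]].
  apply/asboolP => g Gg; rewrite linearD linearZ /= Pv //.
  by have /asboolP/(_ _ Gg) -> := UP _ yU.
rewrite leqNgt -dU (ltn_leqif (dimv_leqif_sup (addvSl U <[v]>))) => /negP; apply.
by apply/negP => /subvP /(_ v); rewrite (subvP (addvSr U <[v]>)) ?memv_line // => /(_ isT).
Qed.

End Invariants.

(* The Hilbert series of a graded space, as its sequence of coefficients. *)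
Definition hilbert_series (K : fieldType) (E : nat -> vectType K)
    (U : forall i, {vspace E i}) (i : nat) : nat := \dim (U i).

Definition gl_act (K : fieldType) (n : nat) (g : 'M[K]_n) : 'End('cV[K]_n) :=
  linfun (mulmx g).

Lemma gl_actE (K : fieldType) (n : nat) (g : 'M[K]_n) v : gl_act g v = g *m v.
Proof. by rewrite lfunE. Qed.

Definition orthogonal_group (K : fieldType) (n : nat) : set 'M[K]_n :=
  [set g | g^T *m g = 1%:M].
Arguments orthogonal_group : clear implicits.

(* Lambda^i (S^2 K^n). *)
Definition ext_sym2 (K : fieldType) (n i : nat) : vectType K :=
  ext_pow i (sym2 'cV[K]_n).

Definition ext_sym2_act (K : fieldType) (n i : nat) (g : 'M[K]_n) :
    'End(ext_sym2 K n i) :=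
  ext_map i (sym2_map (gl_act g)).
Arguments ext_sym2_act : clear implicits.

(* Main.v *)
Require Import Defs.
From HB Require Import structures.
From mathcomp Require Import all_boot all_order all_algebra all_fingroup.
From mathcomp Require Import boolp classical_sets reals.
From mathcomp Require Import complex.
From mathcomp Require Import zify ring.
From mathcomp Require Import fintype finset bigop ssrnat.

Set Implicit Arguments.
Unset Strict Implicit.
Unset Printing Implicit Defensive.

Import Order.TTheory GRing.Theory Num.Theory.
Local Open Scope ring_scope.

(** Let e_1, ..., e_n be the standard basis of V and let X be the symmetric
    matrix whose entry X_ij is the element e_i e_j of degree 1 in the exterior
    algebra of S^2 V; its entries anticommute.  Write t_k for tr(X^k).

    By the first fundamental theorem for O(n), the invariants of degree d are
    spanned by the full contractions of products of d entries of X: the 2d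
    indices are paired off, indices in a pair are equated and summed.
    Contracting two factors multiplies matrices, so each full contraction is, up
    to sign, a product of t_k ([contrs_chain]).  The t_k anticommute up to sign,
    and few of them survive ([ptrace_neq0]).  Moving one factor X around the
    trace gives t_k = - t_k for even k > 0, and reversing the factors does the
    same for k = 3 mod 4.  Finally X^2 has commuting entries and its positive powers
    have trace 0, so that X^(2n) = 0 by the identities of Newton and the theorem
    of Cayley and Hamilton; this is the argument of Rosset for the theorem of
    Amitsur and Levitzki.  Hence the products t_S of the t_(4j+1) over the
    subsets S of the j < n/2 span the invariants.

    They are also independent ([trace_monomials_free]): multiplying a relation
    by the product of the t_(4j+1) with j outside S isolates the coefficient of
    t_S, provided that the product of all of them is not 0.  If n is odd, that
    product has the degree of the top exterior power, which is a line on which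
    rotations and coordinate reflections act trivially.  A nonzero functional on
    this line is invariant, so by the fundamental theorem it is nonzero on some
    t_S; the full product is the only one of that degree
    ([full_monomial_odd_neq0]).  If n is even, setting the first row and column
    of X to 0 reduces to n - 1 ([full_monomial_neq0]).

    So the Hilbert series is the product of the 1 + t^(4j+1) over j < n/2, and
    the q-binomial theorem with q = t^4 expands it as the stated sum
    ([hilbert_polynomial_prod]): the bounded sums over tuples are Gaussian
    binomial coefficients; the index p = 2q contributes the term of z^q, where
    z = t^5, and p = 2q+1 contributes t times that term.

    The fundamental theorem is used in its dual form
    ([invariant_matchings_eq0]): an invariant tensor all of whose full
    contractions vanish is 0.  One shows by induction that all contractions
    vanish, so that the tensor is traceless.  For a traceless tensor, invariance
    under infinitesimal rotations says that the sum of the transpositions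
    exchanging a given index with each of the others acts as the scalar 1 - n.
    Only an alternating tensor with n indices can satisfy this, and a coordinate
    reflection changes its sign.  The dual form bounds the dimension of the
    invariants because the exterior powers of S^2 V carry a nondegenerate
    pairing for which transposition of matrices is the adjoint
    ([ext_pair_adjoint]). *)


(** * The Hilbert series as a product *)

Section GaussianBinomials.
Variable R : comNzRingType.
Variable y : R.

Fixpoint gauss (r q : nat) : R :=
  match r, q with
  | _, 0%N => 1
  | 0%N, _.+1 => 0
  | r.+1, q.+1 => gauss r q + y ^+ q.+1 * gauss r q.+1
  end.

Lemma gauss_n0 r : gauss r 0 = 1. Proof. by case: r. Qed.

Lemma gauss_small r q : (r < q)%N -> gauss r q = 0.
Proof.
elim: r q => [|r IH] [|q] //= rq.
by rewrite !IH ?mulr0 ?addr0 // ltnW.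
Qed.

Lemma gauss_nn r : gauss r r = 1.
Proof. by elim: r => //= r ->; rewrite gauss_small // mulr0 addr0. Qed.

(** Split off the factor 1 + z and replace z by z y in the others; this turns the
    recursion of the Gaussian binomials into that of the coefficients. *)
Lemma q_binomial r z :
  \prod_(k < r) (1 + z * y ^+ k)
  = \sum_(q < r.+1) z ^+ q * y ^+ 'C(q, 2) * gauss r q.
Proof.
elim: r z => [|r IH] z; first by rewrite big_ord0 big_ord1 /= !mulr1.
rewrite big_ord_recl mulr1.
under eq_bigr => k _ do rewrite /bump /= exprS mulrA.
rewrite IH mulrDl mul1r [RHS]big_ord_recl /= bin0n /= !mulr1.
set S := z * \sum_(i < _) _; rewrite big_ord_recl /= !mulr1 gauss_n0.
rewrite [X in 1 + X](_ : _ =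
    \sum_(q < r.+1) (z ^+ q.+1 * y ^+ 'C(q.+1, 2) * gauss r q
      + (z * y) ^+ q.+1 * y ^+ 'C(q.+1, 2) * gauss r q.+1)); last first.
  apply: eq_bigr => q _; rewrite /bump /= exprMn mulrDr; congr (_ + _).
  by rewrite [in RHS]mulrAC !mulrA; ring.
rewrite big_split /= addrA addrAC; congr (_ + _ + _); last first.
  rewrite /S mulr_sumr; apply: eq_bigr => q _.
  by rewrite binS bin1 addnC exprD exprS exprMn; ring.
  rewrite [in RHS]big_ord_recr /= gauss_small // mulr0 addr0.
  by [].
by rewrite expr0 mulr1.
Qed.


(** gauss (N + q) q enumerates the partitions into at most N parts of size at most q.
    This sorts those with parts of size at most q+1 by the multiplicity e of the
    part q+1. *)
Lemma gauss_sum N q :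
  gauss (N + q.+1) q.+1 = \sum_(e < N.+1) y ^+ (q.+1 * e) * gauss (N - e + q) q.
Proof.
elim: N => [|N IH]; first by rewrite big_ord1 gauss_nn subnn gauss_nn muln0 mulr1.
rewrite big_ord_recl muln0 mul1r subn0 [in LHS]addSn /=.
rewrite -addSnnS; congr (_ + _).
rewrite addSnnS IH mulr_sumr; apply: eq_bigr => e _.
by rewrite mulrA -exprD -mulnS.
Qed.

End GaussianBinomials.

Lemma sum_parity (R : nmodType) (f : nat -> R) (K : nat) :
  \sum_(c < K | ~~ odd c) f c = \sum_(e < uphalf K) f e.*2
  /\ \sum_(c < K | odd c) f c = \sum_(e < K./2) f e.*2.+1.
Proof.
elim: K => [|K [IHe IHo]]; first by rewrite !big_ord0.
have recr (P : pred nat) : \sum_(c < K.+1 | P c) f c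
    = \sum_(c < K | P c) f c + (if P K then f K else 0).
  by rewrite [in LHS]big_mkcond big_ord_recr /= -big_mkcond.
rewrite (recr (fun c => ~~ odd c)) (recr odd) IHe IHo {recr IHe IHo}.
rewrite /= uphalf_half; have := odd_double_half K.
case: (odd K) => /= KE; rewrite ?addr0 ?add0n ?add1n; split=> //.
  by rewrite big_ord_recr /= -[in f K]KE.
by rewrite big_ord_recr /= -[in f K]KE.
Qed.

Lemma sum_ffun_ordS (R : nmodType) (T : finType) (q : nat)
    (P : pred {ffun 'I_q.+1 -> T}) (F : {ffun 'I_q.+1 -> T} -> R) :
  let ext (c : T) (b : {ffun 'I_q -> T}) :=
    [ffun j => if unlift ord_max j is Some j' then b j' else c] in
  \sum_(a | P a) F a
  = \sum_(c : T) \sum_(b : {ffun 'I_q -> T} | P (ext c b)) F (ext c b).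
Proof.
move=> ext; rewrite pair_big_dep /=.
rewrite (reindex (fun p : T * {ffun 'I_q -> T} => ext p.1 p.2)) //.
exists (fun a : {ffun 'I_q.+1 -> T} => (a ord_max, [ffun j => a (lift ord_max j)])).
  move=> [c b] _ /=; rewrite ffunE unlift_none; congr (_, _).
  by apply/ffunP => j; rewrite !ffunE liftK.
move=> a _; apply/ffunP => j; rewrite ffunE /=.
by case: unliftP => [j' ->|->] //; rewrite ffunE.
Qed.

Section BoundedSums.
Variable B : nat.

(** The bound B on the entries is kept apart from the bound M on their sum, since
    peeling off an entry lowers M but must not change the type of the tuples. *)
Definition even_sum (q M : nat) : {poly int} :=
  \sum_(a : {ffun 'I_q -> 'I_B.+1}
        | ((\sum_(j < q) a j <= M)%N) && [forall j : 'I_q, ~~ odd (a j)])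
      'X^(\sum_(j < q) 2 * j.+1 * a j)%N.

(** The parity asked of the last entry is a parameter because even p wants it odd
    and odd p wants it even; the other entries are even in both cases. *)
Lemma split_last (o : bool) (q M : nat) :
  \sum_(a : {ffun 'I_q.+1 -> 'I_B.+1}
        | ((\sum_(j < q.+1) a j <= M)%N) &&
          [forall j : 'I_q.+1, if j.+1 == q.+1 then odd (a j) == o else ~~ odd (a j)])
      'X^(\sum_(j < q.+1) 2 * j.+1 * a j)%N
  = \sum_(c < B.+1 | (c <= M)%N && (odd c == o))
       'X^(2 * q.+1 * c) * even_sum q (M - c).
Proof.
rewrite sum_ffun_ordS [RHS]big_mkcond /=; apply: eq_bigr => c _.
pose ext (b : {ffun 'I_q -> 'I_B.+1}) : {ffun 'I_q.+1 -> 'I_B.+1} :=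
  [ffun j => if unlift ord_max j is Some j' then b j' else c].
have extM b : ext b ord_max = c by rewrite ffunE unlift_none.
have extW b j : ext b (widen_ord (leqnSn q) j) = b j.
  rewrite ffunE; have -> : widen_ord (leqnSn q) j = lift ord_max j.
    by apply/val_inj; rewrite /= /bump leqNgt ltn_ord.
  by rewrite liftK.
have extP b : ((\sum_(j < q.+1) ext b j <= M)%N &&
    [forall j : 'I_q.+1,
        if j.+1 == q.+1 then odd (ext b j) == o else ~~ odd (ext b j)])
  = ((c <= M)%N && (odd c == o)) &&
    ((\sum_(j < q) b j <= M - c)%N && [forall j : 'I_q, ~~ odd (b j)]).
  rewrite big_ord_recr /= extM.
  under eq_bigr => j _ do rewrite extW.
  have -> : (\sum_(j < q) b j + c <= M)%N
      = (c <= M)%N && (\sum_(j < q) b j <= M - c)%N by apply/idP/idP; lia.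
  rewrite -!andbA; congr (_ && _).
  rewrite [in RHS]andbCA; congr (_ && _).
  apply/forallP/andP => [H|[Hc /forallP Hb] j].
    split; first by have := H ord_max; rewrite extM eqxx.
    apply/forallP => j; have := H (widen_ord (leqnSn q) j).
    by rewrite extW /= eqSS ltn_eqF.
  case: (unliftP ord_max j) => [j' ->|->]; last by rewrite extM /= eqxx.
  have -> : lift ord_max j' = widen_ord (leqnSn q) j'.
    by apply/val_inj; rewrite /= /bump leqNgt ltn_ord.
  by rewrite extW /= eqSS ltn_eqF.
under eq_bigl => b do rewrite -/(ext b) extP.
case: ifP => [_|_]; last by rewrite big1.
rewrite /even_sum mulr_sumr; apply: eq_bigr => b _.
rewrite -/(ext b) big_ord_recr /= extM -exprD addnC; congr ('X^(_ + _)%N).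
by apply: eq_bigr => j _; rewrite extW.
Qed.

Lemma sum_le_bound (R : nmodType) (f : nat -> R) (P : pred nat) (M : nat) :
  (M <= B)%N ->
  \sum_(c < B.+1 | (c <= M)%N && P c) f c = \sum_(c < M.+1 | P c) f c.
Proof.
move=> MB; rewrite [RHS](big_ord_widen_cond B.+1 P f) ?ltnS //.
by apply: eq_bigl => c; rewrite andbC ltnS.
Qed.

(** Halving the entries turns even tuples into multiplicities of the parts
    1, ..., q of a partition with at most M/2 parts, weighted by t^4. *)
Lemma even_sumE q M : (M <= B)%N -> even_sum q M = gauss 'X^4 (M./2 + q) q.
Proof.
elim: q M => [|q IH] M MB.
  rewrite /even_sum (big_pred1 [ffun=> ord0]); last first.
    move=> a; rewrite big_ord0 /=; apply/idP/idP => _; last by apply/forallP => [[]].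
    by apply/eqP/ffunP => [[]].
  by rewrite big_ord0 gauss_n0.
rewrite gauss_sum; have := split_last false q M.
rewrite (sum_le_bound (fun c => 'X^(2 * q.+1 * c) * even_sum q (M - c))
  (fun c => odd c == false)) //.
rewrite (eq_bigl (fun c : 'I_M.+1 => ~~ odd c)); last by move=> c; case: (odd c).
rewrite (sum_parity (fun c => 'X^(2 * q.+1 * c) * even_sum q (M - c)) _).1 => E.
transitivity (\sum_(e < uphalf M.+1)
   'X^(2 * q.+1 * (val e).*2) * even_sum q (M - (val e).*2)).
  rewrite -E; apply: eq_bigl => a; congr (_ && _).
  by apply: eq_forallb => j; case: ifP => _ //; case: (odd _).
apply: eq_bigr => e _ /=; rewrite IH; last by lia.
rewrite -exprM; congr ('X^_ * gauss _ _ _); lia.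
Qed.

(** Writing the odd last entry as 2e+1 leaves an even sum with bound M - 1; for
    M = 0 there is none, and the Gaussian binomial vanishes too. *)
Lemma last_odd_sumE q M : (M <= B)%N ->
  (\sum_(a : {ffun 'I_q.+1 -> 'I_B.+1}
        | ((\sum_(j < q.+1) a j <= M)%N) &&
          [forall j : 'I_q.+1, if j.+1 == q.+1 then odd (a j) else ~~ odd (a j)])
      'X^(\sum_(j < q.+1) 2 * j.+1 * a j)%N : {poly int})
  = 'X^(2 * q.+1) * gauss 'X^4 (uphalf M + q) q.+1.
Proof.
move=> MB; have := split_last true q M.
rewrite (sum_le_bound (fun c => 'X^(2 * q.+1 * c) * even_sum q (M - c))
  (fun c => odd c == true)) //.
rewrite (eq_bigl (fun c : 'I_M.+1 => odd c)); last by move=> c; case: (odd c).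
rewrite (sum_parity (fun c => 'X^(2 * q.+1 * c) * even_sum q (M - c)) _).2 => E.
transitivity (\sum_(e < M.+1./2)
   'X^(2 * q.+1 * (val e).*2.+1) * even_sum q (M - (val e).*2.+1)).
  rewrite -E; apply: eq_bigl => a; congr (_ && _).
  by apply: eq_forallb => j; case: ifP => _ //; case: (odd _).
case: M {E} MB => [|M] MB; first by rewrite big_ord0 add0n gauss_small ?mulr0.
rewrite (_ : (uphalf M.+1 + q = M./2 + q.+1)%N); last by lia.
rewrite gauss_sum mulr_sumr; apply: eq_bigr => e _ /=.
rewrite even_sumE; last by lia.
rewrite -exprM mulrA -exprD; congr ('X^_ * gauss _ _ _); lia.
Qed.

End BoundedSums.


Definition even_term (n p : nat) : {poly int} :=
  'X^((p * p.+1)./2) *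
  (\sum_(a : {ffun 'I_(p./2) -> 'I_(n - p).+1}
        | ((\sum_(j < p./2) a j <= n - p)%N) &&
          [forall j : 'I_(p./2),
             if j.+1 == p./2 then odd (a j) else ~~ odd (a j)])
      'X^(\sum_(j < p./2) 2 * j.+1 * a j)%N).

Definition odd_term (n p : nat) : {poly int} :=
  'X^((p * p.+1)./2) *
  (\sum_(a : {ffun 'I_(p.-1./2) -> 'I_(n - p).+1}
        | ((\sum_(j < p.-1./2) a j <= n - p)%N) &&
          [forall j : 'I_(p.-1./2), ~~ odd (a j)])
      'X^(\sum_(j < p.-1./2) 2 * j.+1 * a j)%N).

Lemma bin2_expr (q : nat) :
  'X^5 ^+ q * 'X^4 ^+ 'C(q, 2) = 'X^(2 * q * q + 3 * q) :> {poly int}.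
Proof.
rewrite -!exprM -exprD; congr ('X^_).
elim: q => // q IH; rewrite binS bin1; nia.
Qed.

Lemma even_termE n q : (q.+1.*2 <= n)%N ->
  even_term n q.+1.*2 = 'X^5 ^+ q.+1 * 'X^4 ^+ 'C(q.+1, 2) * gauss 'X^4 n.-1./2 q.+1.
Proof.
move=> qn; rewrite /even_term doubleK last_odd_sumE // bin2_expr mulrA -exprD.
have -> : (uphalf (n - q.+1.*2) + q = n.-1./2)%N by lia.
congr ('X^_ * _).
have -> : (q.+1.*2 * q.+1.*2.+1 = (q.+1 * q.+1.*2.+1).*2)%N by rewrite -!muln2; nia.
rewrite doubleK -muln2; nia.
Qed.

Lemma odd_termE n q : (q.+1.*2.+1 <= n)%N ->
  odd_term n q.+1.*2.+1
  = 'X * ('X^5 ^+ q.+1 * 'X^4 ^+ 'C(q.+1, 2) * gauss 'X^4 n.-1./2 q.+1).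
Proof.
move=> qn; rewrite /odd_term -[_.*2.+1.-1]/(q.+1.*2) doubleK.
rewrite -/(even_sum (n - q.+1.*2.+1) q.+1 (n - q.+1.*2.+1)) even_sumE //.
rewrite bin2_expr mulrA -exprS.
have -> : ((n - q.+1.*2.+1)./2 + q.+1 = n.-1./2)%N by lia.
congr ('X^_ * _).
have -> : (q.+1.*2.+1 * q.+1.*2.+2 = (q.+1.*2.+1 * q.+2).*2)%N by rewrite -!muln2; nia.
rewrite doubleK -muln2; nia.
Qed.

(** The factor 1 + t of the product accounts for pairing the terms p = 2q and
    p = 2q+1 of the sum; the remaining factors have the form 1 + z y^k with
    z = t^5 and y = t^4, so the q-binomial theorem applies. *)
Lemma hilbert_polynomial_prod (n : nat) : (1 <= n)%N ->
  1 + 'X + \sum_(2 <= p < n.+1 | ~~ odd p) even_term n p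
    + \sum_(3 <= p < n.+1 | odd p) odd_term n p
  = \prod_(k < uphalf n) (1 + 'X^((4 * k).+1)).
Proof.
move=> n1; pose r := n.-1./2.
have nr : uphalf n = r.+1 by rewrite /r; lia.
pose c q : {poly int} := 'X^5 ^+ q * 'X^4 ^+ 'C(q, 2) * gauss 'X^4 r q.
have -> : \prod_(k < uphalf n) (1 + 'X^((4 * k).+1))
    = (1 + 'X) * \sum_(q < r.+1) c q :> {poly int}.
  rewrite nr big_ord_recl muln0 expr1 -q_binomial; congr (_ * _).
  apply: eq_bigr => k _; rewrite -exprM -exprD; congr (1 + 'X^_).
  by rewrite /= /bump mulnDr.
have -> : \sum_(2 <= p < n.+1 | ~~ odd p) even_term n p = \sum_(q < r) c q.+1.
  rewrite big_geq_mkord big_mkcondr /=.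
  rewrite (sum_parity (fun p => if (2 <= p)%N then even_term n p else 0) _).1.
  rewrite [uphalf _]/= big_ord_recl add0r.
  transitivity (\sum_(i < n./2) c i.+1).
    apply: eq_bigr => q _; rewrite lift0 even_termE //.
    by have := ltn_ord q; lia.
  (* For even n, the sum over p has one more term, p = n, which is empty. *)
  case: (ltnP r n./2) => rn; last first.
    by have -> : n./2 = r by rewrite /r in nr rn *; lia.
  have -> : n./2 = r.+1 by rewrite /r in nr rn *; lia.
  by rewrite big_ord_recr /= [c r.+1]/c gauss_small // mulr0 addr0.
have -> : \sum_(3 <= p < n.+1 | odd p) odd_term n p = \sum_(q < r) 'X * c q.+1.
  rewrite big_geq_mkord big_mkcondr /=.
  rewrite (sum_parity (fun p => if (3 <= p)%N then odd_term n p else 0) _).2.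
  have -> : n.+1./2 = r.+1 by rewrite /r; lia.
  rewrite big_ord_recl add0r.
  apply: eq_bigr => q _; rewrite lift0 odd_termE //.
  by have := ltn_ord q; rewrite /r; lia.
rewrite big_ord_recl [c 0]/c !expr0 gauss_n0 !mulr1 -mulr_sumr.
rewrite (eq_bigr (fun q : 'I_r => c q.+1)) => [|q _]; last by [].
ring.
Qed.

(** * The first fundamental theorem for the orthogonal group *)

Lemma deriv_prod (R : comNzRingType) (I : eqType) (r : seq I) (p : I -> {poly R}) :
  uniq r ->
  (\prod_(x <- r) p x)^`() = \sum_(x <- r) (p x)^`() * \prod_(y <- r | y != x) p y.
Proof.
elim: r => [|x r IH] /=; first by rewrite !big_nil derivC.
move=> /andP[xr ur]; rewrite !big_cons derivM IH // eqxx; congr (_ * _ + _).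
  rewrite big_seq [in RHS]big_seq_cond; apply: eq_bigl => y.
  by case yr: (y \in r) => //=; apply/esym; apply: contraNneq xr => <-.
rewrite mulr_sumr [LHS]big_seq [RHS]big_seq; apply: eq_bigr => y yr.
rewrite big_cons ifT; first by rewrite mulrCA.
by apply: contraNneq xr => E; rewrite ?E // -?E.
Qed.

Section Tensors.
Variables (I : finType) (n : nat).
Implicit Types (w : {ffun I -> 'I_n}) (F A : {set I}).
Local Notation word := {ffun I -> 'I_n}.

Definition upd w (a : I) (c : 'I_n) : word := [ffun x => if x == a then c else w x].

Definition swap_word w (a b : I) : word := [ffun x => w (tperm a b x)].

(** The contracted indices a and b stay in the index type, as indices on which the
    result does not depend.  Iterated contractions thus need no change of type;
    the set F of indices still alive is carried along instead. *)
Definition contr (V : nmodType) (a b : I) (T : word -> V) : word -> V :=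
  fun w => \sum_c T (upd (upd w a c) b c).

Definition contrs (V : nmodType) (s : seq (I * I)) (T : word -> V) : word -> V :=
  foldl (fun T' p => contr p.1 p.2 T') T s.

Definition ends (s : seq (I * I)) : seq I := flatten [seq [:: p.1; p.2] | p <- s].

Lemma upd_same w a c d : upd (upd w a c) a d = upd w a d.
Proof. by apply/ffunP => x; rewrite !ffunE; case: eqP. Qed.

Lemma updC w a b c d : a != b -> upd (upd w a c) b d = upd (upd w b d) a c.
Proof.
move=> ab; apply/ffunP => x; rewrite !ffunE.
by case: eqP => // ->; rewrite eq_sym (negPf ab).
Qed.

Lemma upd_self w a : upd w a (w a) = w.
Proof. by apply/ffunP => x; rewrite !ffunE; case: eqP => [->|]. Qed.

Lemma swap_wordE w a b : a != b -> swap_word w a b = upd (upd w a (w b)) b (w a).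
Proof.
move=> ab; apply/ffunP => x; rewrite !ffunE.
case: tpermP => [->|->|/eqP xa /eqP xb]; first by rewrite eqxx (negPf ab).
  by rewrite eqxx.
by rewrite (negPf xa) (negPf xb).
Qed.

Lemma swap_wordC w a b : swap_word w a b = swap_word w b a.
Proof. by rewrite /swap_word tpermC. Qed.

Lemma swap_wordK w a b : swap_word (swap_word w a b) a b = w.
Proof. by apply/ffunP => x; rewrite !ffunE tpermK. Qed.

(** A transposition moves past another one at the cost of conjugating it. *)
Lemma swap_word_conj w a b c d :
  swap_word (swap_word w a b) c d
  = swap_word (swap_word w (tperm a b c) (tperm a b d)) a b.
Proof.
apply/ffunP => x; rewrite !ffunE; congr (w _).
by rewrite -!permM -tpermJ conjgE tpermV mulgA mulgA tperm2 mul1g.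
Qed.

Lemma contrs_eq (V : nmodType) s (T T' : word -> V) :
  T =1 T' -> contrs s T =1 contrs s T'.
Proof.
elim: s T T' => //= p s IH T T' E; apply: IH => w.
by apply: eq_bigr => c _; rewrite E.
Qed.

Lemma contrs_morph (V V' : nmodType) (f : V -> V') s T w :
  (forall F : 'I_n -> V, f (\sum_c F c) = \sum_c f (F c)) ->
  contrs s (f \o T) w = f (contrs s T w).
Proof.
move=> fD; elim: s T w => //= p s IH T w; rewrite -IH; apply: contrs_eq => v.
by rewrite /= /contr fD.
Qed.

(** Applied at both indices of a contracted pair this adds 2 [c = i], which leaves
    the parity unchanged. *)
Lemma card_upd F w a c i : a \in F ->
  #|[set x in F | upd w a c x == i]| = (#|[set x in F :\ a | w x == i]| + (c == i))%N.
Proof.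
move=> aF; rewrite (cardsD1 a) inE aF ffunE eqxx addnC; congr (_ + _)%N.
by apply: eq_card => x; rewrite !inE ffunE; case: (x =P a).
Qed.

Section Invariants.
Variable K : numFieldType.
Implicit Types T : word -> K.

(** Invariance under the Lie algebra element E_ij - E_ji acting on the indices in F. *)
Definition lie_invariant F T := forall (i j : 'I_n) w, i != j ->
  \sum_(x in F) ((w x == i)%:R * T (upd w x j) - (w x == j)%:R * T (upd w x i)) = 0.

(** Invariance under the coordinate reflections: each of them multiplies the entry
    of T at w by a sign, the parity of the number of occurrences of a letter. *)
Definition parity_invariant F T := forall (i : 'I_n) w,
  odd #|[set x in F | w x == i]| -> T w = 0.

Definition traceless F T := forall a b, a \in F -> b \in F -> a != b ->
  forall w, contr a b T w = 0.

Definition swap_eigen F T := forall a w, a \in F ->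
  \sum_(x in F :\ a) T (swap_word w a x) = - (n%:R - 1) * T w.

Definition antisym A T := forall a b, a \in A -> b \in A -> a != b ->
  forall w, T (swap_word w a b) = - T w.

Lemma sum_delta (i : 'I_n) (P : pred 'I_n) (f : 'I_n -> K) :
  \sum_(j | P j) (i == j)%:R * f j = if P i then f i else 0.
Proof.
rewrite big_mkcond (bigD1 i) //= eqxx mul1r big1 ?addr0 // => j ji.
by rewrite eq_sym (negPf ji) mul0r if_same.
Qed.

(** Change the letter i at a into j <> i and apply the rotation that turns j back
    into i.  At a this restores w.  At another index with letter j it exchanges the
    two letters.  At another index with letter i it writes j twice; summed over j,
    tracelessness replaces these terms by the one with i twice, which is the
    exchange of two equal letters.  Sum over the n - 1 letters j. *)
Lemma lie_invariant_swap_eigen F T : lie_invariant F T -> traceless F T -> swap_eigen F T.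
Proof.
move=> TI T0 a w aF; pose i := w a.
pose t j x := (w x == j)%:R * T (upd (upd w a j) x i)
  - (w x == i)%:R * T (upd (upd w a j) x j).
have E j : j != i -> T w + \sum_(x in F :\ a) t j x = 0.
  move=> ji; rewrite -[RHS](TI _ _ (upd w a j) ji) [RHS](big_setD1 a aF) /=.
  rewrite ffunE eqxx eqxx mul1r (negPf ji) mul0r subr0 upd_same upd_self.
  congr (_ + _); apply: eq_bigr => x; rewrite !inE => /andP[xa _].
  by rewrite !ffunE (negPf xa).
have : \sum_(j | j != i) (T w + \sum_(x in F :\ a) t j x) = 0 by rewrite big1.
rewrite big_split /= sumr_const exchange_big /= => S.
have card_i : #|[pred j | j != i]| = n.-1.
  by rewrite (cardC1 i) card_ord.
have nE : n%:R - 1 = n.-1%:R :> K.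
  by rewrite -subn1 natrB // (leq_ltn_trans _ (ltn_ord i)).
rewrite mulNr nE mulr_natl -card_i; apply/eqP; rewrite -addr_eq0 addrC -[X in _ == X]S.
rewrite (eq_bigr (fun x => \sum_(j | j != i) t j x)) // => x.
rewrite !inE => /andP[xa xF]; rewrite /t sumrB sum_delta.
have ax : a != x by rewrite eq_sym.
case: (eqVneq (w x) i) => [wx|wx] /=.
  rewrite sub0r -mulr_sumr mul1r.
  have := T0 _ _ aF xF ax w; rewrite /contr (bigD1 i) //= => /eqP.
  rewrite addrC addr_eq0 => /eqP ->; rewrite opprK; congr T.
  by rewrite swap_wordE // wx.
by rewrite big1 ?subr0 ?swap_wordE // => j _; rewrite mul0r.
Qed.

Lemma antisym_repeat A T w a b : antisym A T -> a \in A -> b \in A -> a != b ->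
  w a = w b -> T w = 0.
Proof.
move=> TA aA bA ab wab; have := TA _ _ aA bA ab w.
have -> : swap_word w a b = w.
  by rewrite swap_wordE // -wab upd_self wab upd_self.
by move/eqP; rewrite -addr_eq0 -mulr2n -mulr_natr mulf_eq0 pnatr_eq0 orbF => /eqP.
Qed.

Lemma tperm_in (A : {set I}) a b x : a \in A -> b \in A ->
  (tperm a b x \in A) = (x \in A).
Proof. by move=> aA bA; case: tpermP => [->|->|]; rewrite ?aA ?bA. Qed.

Lemma swap_eigen_swap F T a b : a \in F -> b \in F -> swap_eigen F T ->
  swap_eigen F (fun w => T (swap_word w a b)).
Proof.
move=> aF bF TE c w cF.
have inF x := tperm_in x aF bF.
rewrite -(TE (tperm a b c)) ?inF //.
rewrite [RHS](reindex_inj (@perm_inj _ (tperm a b))) /=.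
apply: eq_big => [x|x _]; first by rewrite !inE inF (inj_eq perm_inj).
by congr T; rewrite [RHS]swap_word_conj !tpermK.
Qed.

(** For T antisymmetric in A this is, up to a scalar, the antisymmetrization of T
    over the indices in A and c. *)
Definition alternate T A c : word -> K :=
  fun w => T w - \sum_(b in A) T (swap_word w c b).

Lemma alternate_antisym A T c : c \notin A -> antisym A T ->
  antisym (c |: A) (alternate T A c).
Proof.
move=> cA TA.
have step1 b w : b \in A ->
    alternate T A c (swap_word w c b) = - alternate T A c w.
  move=> bA; rewrite /alternate (bigD1 b) //= [in RHS](bigD1 b) //= swap_wordK.
  rewrite (eq_bigr (fun x => - T (swap_word w c x))) => [|x /andP[xA xb]].
    rewrite sumrN; ring.
  have -> : swap_word (swap_word w c b) c x = swap_word (swap_word w c x) b x.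
    rewrite [RHS]swap_word_conj tpermR tpermD 1?(swap_wordC w) //.
    by apply: contraNneq cA => ->.
  by rewrite TA // eq_sym.
have step2 a b w : a \in A -> b \in A -> a != b ->
    alternate T A c (swap_word w a b) = - alternate T A c w.
  move=> aA bA ab; rewrite /alternate TA // opprB [RHS]addrC; congr (_ + _).
  rewrite [RHS](reindex_inj (@perm_inj _ (tperm a b))) -sumrN /=.
  apply: eq_big => [x|x _]; first by rewrite tperm_in.
  rewrite swap_word_conj TA // opprK tpermD //; apply: contraNneq cA => <- //.
move=> a b; rewrite !inE => /orP[/eqP->|aA] /orP[/eqP->|bA] ab w.
- by rewrite eqxx in ab.
- exact: step1.
- by rewrite swap_wordC step1.
- exact: step2.
Qed.

Lemma alternate_eigen F A T c : A \subset F -> c \in F -> swap_eigen F T ->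
  swap_eigen F (alternate T A c).
Proof.
move=> AF cF TE a w aF; rewrite /alternate sumrB exchange_big /= TE // mulrBr.
congr (_ - _); rewrite mulr_sumr; apply: eq_bigr => b bA.
exact: (swap_eigen_swap cF (subsetP AF _ bA) TE w aF).
Qed.

Lemma parity_invariant_swap F T a b : a \in F -> b \in F -> parity_invariant F T ->
  parity_invariant F (fun w => T (swap_word w a b)).
Proof.
move=> aF bF TP i w odd_i; apply: (TP i).
rewrite (_ : #|_| = #|[set x in F | w x == i]|) //.
rewrite -[RHS](card_imset _ (@perm_inj _ (tperm a b))); apply: eq_card => x.
apply/idP/imsetP => [|[y + ->]]; rewrite !inE !ffunE.
  by move=> /andP[xF wx]; exists (tperm a b x); rewrite ?tpermK // !inE tperm_in // xF.
by rewrite tpermK tperm_in.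
Qed.

Lemma alternate_par F A T c : A \subset F -> c \in F -> parity_invariant F T ->
  parity_invariant F (alternate T A c).
Proof.
move=> AF cF TP i w odd_i; rewrite /alternate (TP _ _ odd_i) big1 ?subr0 // => b bA.
exact: (parity_invariant_swap cF (subsetP AF _ bA) TP odd_i).
Qed.

(** Downward induction on A.  If #|A| = k > n, then a word repeats a letter in A.
    Otherwise, antisymmetrizing over one more index c gives 0 by induction, so T is
    the sum of its exchanges of c with the elements of A.  Summing this over c in
    F \ A and using the eigenvalue 1 - n gives (#|F| - k + k (n - k)) T = 0, whose
    coefficient is positive unless A = F.  In that case T is supported on words
    that are injective on F, in which some letter occurs exactly once. *)
Lemma antisym_eq0 F A T : A \subset F -> A != set0 ->
  swap_eigen F T -> parity_invariant F T -> antisym A T -> forall w, T w = 0.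
Proof.
have [m] := ubnP #|F :\: A|; elim: m => // m IH in A T *.
rewrite ltnS => cFA AF A0 TE TP TA w.
have eq0P (k : nat) : (0 < k)%N -> k%:R * T w = 0 -> T w = 0.
  by case: k => // k _ /eqP; rewrite mulf_eq0 pnatr_eq0 => /eqP.
have [/existsP[a /existsP[b /and4P[aA bA ab /eqP wab]]]|winj] :=
    boolP [exists a, exists b, [&& a \in A, b \in A, a != b & w a == w b]].
  exact: antisym_repeat TA aA bA ab wab.
have {}winj : {in A &, injective w}.
  move=> a b aA bA wab; apply: contraNeq winj => ab.
  by apply/existsP; exists a; apply/existsP; exists b; rewrite aA bA ab wab eqxx.
have kn : (#|A| <= n)%N.
  by rewrite -(card_in_imset winj) -[leqRHS]card_ord max_card.
have [FA0|] := eqVneq (F :\: A) set0.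
  (* a letter occurring exactly once *)
  have FA : F = A by apply/eqP; rewrite eqEsubset AF andbT -setD_eq0 FA0.
  have /set0Pn[a aA] := A0; apply: (TP (w a)).
  rewrite (_ : [set x in F | _] = [set a]) ?cards1 //; apply/setP => x.
  rewrite !inE FA; apply/andP/eqP => [[xA /eqP]|->]; last by rewrite aA eqxx.
  exact: winj.
rewrite -card_gt0 => FA0.
have step c : c \in F :\: A -> T w = \sum_(b in A) T (swap_word w c b).
  rewrite inE => /andP[cA cF]; apply/eqP; rewrite -subr_eq0; apply/eqP.
  rewrite -/(alternate T A c w); apply: (IH (c |: A)).
  - apply: leq_trans cFA; apply: proper_card.
    rewrite properE setDS ?subsetUr //=; apply/subsetPn; exists c.
      by rewrite inE cA cF.
    by rewrite !inE eqxx.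
  - by rewrite subUset sub1set cF AF.
  - by apply/set0Pn; exists c; rewrite setU11.
  - exact: alternate_eigen.
  - exact: alternate_par.
  - exact: alternate_antisym.
have : \sum_(c in F :\: A) T w
    = \sum_(b in A) (- (n%:R - 1) * T w + (#|A|%:R - 1) * T w).
  rewrite (eq_bigr _ step) exchange_big /=; apply: eq_bigr => b bA.
  rewrite -(TE b) ?(subsetP AF) //.
  rewrite [\sum_(x in F :\ b) _](big_setID A) /=.
  have -> : (F :\ b) :&: A = A :\ b.
    by rewrite setIDAC; move/setIidPr: AF => ->.
  have -> : (F :\ b) :\: A = F :\: A.
    apply/setP => x; rewrite !inE; case: (x =P b) => [->|//].
    by rewrite bA.
  rewrite [\sum_(x in A :\ b) _](eq_bigr (fun=> - T w)) => [|x]; last first.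
    by rewrite !inE => /andP[xb xA]; rewrite (TA _ _ bA xA) // eq_sym.
  rewrite sumr_const -[_ *+ #|A :\ b|]mulr_natl.
  rewrite (eq_bigr _ (fun c _ => congr1 T (swap_wordC w c b))).
  have -> : #|A :\ b|%:R = #|A|%:R - 1 :> K.
    by rewrite [in RHS](cardsD1 b) bA natrD addrAC subrr add0r.
  ring.
rewrite !sumr_const -[_ *+ #|A|]mulr_natl -[_ *+ #|F :\: A|]mulr_natl => E.
apply: (eq0P (#|F :\: A| + #|A| * (n - #|A|))%N); first by rewrite addn_gt0 FA0.
rewrite natrD natrM natrB // mulrDl E; ring.
Qed.

Lemma traceless_inv_eq0 F T : F != set0 ->
  lie_invariant F T -> parity_invariant F T -> traceless F T -> forall w, T w = 0.
Proof.
move=> /set0Pn[a aF] TI TP T0.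
apply: (@antisym_eq0 F [set a]) => //.
- by rewrite sub1set.
- by apply/set0Pn; exists a; rewrite inE.
- exact: lie_invariant_swap_eigen.
- by move=> b c; rewrite !inE => /eqP-> /eqP->; rewrite eqxx.
Qed.

Lemma contr_par F T a b : a \in F -> b \in F -> a != b -> parity_invariant F T ->
  parity_invariant (F :\ a :\ b) (contr a b T).
Proof.
move=> aF bF ab TP i w odd_i; rewrite /contr big1 // => c _; apply: (TP i).
rewrite card_upd // card_upd; last by rewrite !inE ab.
rewrite (_ : F :\ b :\ a = F :\ a :\ b); last by rewrite !setDDl setUC.
by rewrite !oddD odd_i; case: (c == i).
Qed.

(** The two terms in which the rotation acts on the contracted pair cancel,
    because the contraction is itself invariant. *)
Lemma contr_inf F T a b : a \in F -> b \in F -> a != b -> lie_invariant F T ->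
  lie_invariant (F :\ a :\ b) (contr a b T).
Proof.
move=> aF bF ab TI i j w ij.
pose t c x := let v := upd (upd w a c) b c in
  (v x == i)%:R * T (upd v x j) - (v x == j)%:R * T (upd v x i).
have ba : b != a by rewrite eq_sym.
have bFa : b \in F :\ a by rewrite !inE ba.
transitivity (\sum_c \sum_(x in F :\ a :\ b) t c x).
  rewrite exchange_big /=; apply: eq_bigr => x; rewrite !inE => /and3P[xb xa _].
  rewrite /contr !mulr_sumr -sumrB; apply: eq_bigr => c _.
  rewrite /t /= !ffunE (negPf xa) (negPf xb).
  by rewrite !(updC _ _ _ xa) !(updC _ _ _ xb).
transitivity (\sum_c (- t c a - t c b)).
  apply: eq_bigr => c _; apply/eqP.
  have := TI i j (upd (upd w a c) b c) ij.
  rewrite (big_setD1 a) //= (big_setD1 b) //= => /eqP.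
  by rewrite -/(t c a) -/(t c b) addrA addrC addr_eq0 opprD => E; rewrite -(eqP E).
have sumt (f : 'I_n -> K) (k : 'I_n) : \sum_c (c == k)%:R * f c = f k.
  by rewrite (bigD1 k) //= eqxx mul1r big1 ?addr0 // => c /negPf ->; rewrite mul0r.
pose v c := upd (upd w a c) b c.
have va c : v c a = c by rewrite !ffunE (negPf ab) eqxx.
have vb c : v c b = c by rewrite !ffunE eqxx.
have swapv (x y : 'I_n) : upd (v x) a y = upd (v y) b x.
  by rewrite /v [in RHS]upd_same -(updC _ _ _ ab) upd_same.
have ta : \sum_c t c a = T (upd (v i) a j) - T (upd (v j) a i).
  rewrite -(sumt (fun c => T (upd (v c) a j)) i) -(sumt (fun c => T (upd (v c) a i)) j).
  by rewrite -sumrB; apply: eq_bigr => c _; rewrite /t /= -/(v c) va.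
have tb : \sum_c t c b = T (upd (v i) b j) - T (upd (v j) b i).
  rewrite -(sumt (fun c => T (upd (v c) b j)) i) -(sumt (fun c => T (upd (v c) b i)) j).
  by rewrite -sumrB; apply: eq_bigr => c _; rewrite /t /= -/(v c) vb.
by rewrite sumrB sumrN ta tb !swapv; ring.
Qed.

Lemma ends_cons p s : ends (p :: s) = p.1 :: p.2 :: ends s. Proof. by []. Qed.

(** Contracting one pair of indices in F gives a tensor with the same properties
    on the remaining ones, hence 0 by induction: T is traceless. *)
Theorem lie_invariant_matchings_eq0 F T : lie_invariant F T -> parity_invariant F T ->
  (forall s, perm_eq (ends s) (enum F) -> forall w, contrs s T w = 0) ->
  forall w, T w = 0.
Proof.
have [m] := ubnP #|F|; elim: m => // m IH in F T *.
rewrite ltnS => Fm TI TP TM.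
have [F0|F0] := eqVneq F set0.
  by apply: (TM [::]); rewrite F0 enum_set0.
apply: (traceless_inv_eq0 F0) => // a b aF bF ab.
have bFa : b \in F :\ a by rewrite !inE eq_sym ab.
apply: (IH (F :\ a :\ b)).
- apply: leq_trans Fm; rewrite (cardsD1 a F) aF (cardsD1 b (F :\ a)) bFa.
  by rewrite add1n add1n ltnS leqnSn.
- exact: contr_inf.
- exact: contr_par.
move=> s sF; apply: (TM ((a, b) :: s)); rewrite ends_cons /=.
apply: uniq_perm; rewrite ?enum_uniq //=.
  rewrite (perm_uniq sF) enum_uniq andbT inE negb_or ab /=.
  by rewrite !(perm_mem sF) !mem_enum !inE !eqxx !andbF.
move=> x; rewrite mem_enum !inE (perm_mem sF) mem_enum !inE.
have [->|_] := eqVneq x a; rewrite //= ?andbT.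
by have [->|_] := eqVneq x b.
Qed.

End Invariants.

Section Rotations.
Variable K : numFieldType.
Implicit Types (T : word -> K) (G : 'M[K]_n).

(** The rational parametrization of the rotations in a coordinate plane: it makes
    invariance a polynomial identity in t, which can be differentiated at t = 0
    over any field of characteristic 0. *)
Definition plane_rotation (i j : 'I_n) (t : K) : 'M[K]_n :=
  \matrix_(k, l)
    if k == l then (if (k == i) || (k == j) then (1 - t ^+ 2) / (1 + t ^+ 2) else 1)
    else if (k == i) && (l == j) then t *+ 2 / (1 + t ^+ 2)
    else if (k == j) && (l == i) then - (t *+ 2) / (1 + t ^+ 2) else 0.

Definition coord_reflection (i : 'I_n) : 'M[K]_n :=
  \matrix_(k, l) if k == l then (-1) ^+ (k == i) else 0.

(** The action of G on functionals rather than on tensors, hence the transposed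
    order of the indices of G. *)
Definition fixes T G :=
  forall w, T w = \sum_(v : word) (\prod_x G (v x) (w x)) * T v.

Lemma fixes_par T : (forall i, fixes T (coord_reflection i)) -> parity_invariant setT T.
Proof.
move=> TG i w odd_i; have := TG i w; rewrite (bigD1 w) //=.
rewrite [\sum_(v | v != w) _]big1 ?addr0 => [|v vw].
  have -> : \prod_x coord_reflection i (w x) (w x) = -1.
    rewrite (eq_bigr (fun x => if w x == i then -1 else 1 : K)) => [|x _].
      rewrite -big_mkcond /= prodr_const -signr_odd; move: odd_i.
      rewrite (_ : #|_| = #|[pred x | w x == i]|) => [->|]; first by rewrite expr1.
      by apply: eq_card => x; rewrite !inE.
    by rewrite mxE eqxx; case: (_ == i).
  rewrite mulN1r => /eqP; rewrite -addr_eq0 -mulr2n -mulr_natr.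
  by rewrite mulf_eq0 pnatr_eq0 orbF => /eqP.
have [x vwx] : exists x, v x != w x.
  apply/existsP; apply: contraNT vw => /existsPn E; apply/eqP/ffunP => x.
  by apply/eqP; rewrite -[_ == _]negbK E.
by rewrite (bigD1 x) //= mxE (negPf vwx) !mul0r.
Qed.

Lemma poly_nat_eq0 (p : {poly K}) : (forall k : nat, p.[k%:R] = 0) -> p = 0.
Proof.
move=> pk; apply/eqP; apply/negPn/negP => p0.
have := max_poly_roots (rs := [seq k%:R | k <- iota 0 (size p)]) p0.
rewrite size_map size_iota ltnn => H; suff : false by []; apply: H.
  by apply/allP => _ /mapP[k _ ->]; apply/eqP/pk.
by rewrite map_inj_uniq ?iota_uniq // => k l /eqP; rewrite eqr_nat => /eqP.
Qed.

Lemma sum_upd (V : nmodType) w x (f : word -> V) :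
  \sum_(v : word | [forall y, (y != x) ==> (v y == w y)]) f v = \sum_c f (upd w x c).
Proof.
rewrite (reindex_onto (upd w x) (fun v => v x)) => [|v /forallP vw] /=; last first.
  apply/ffunP => y; rewrite ffunE; case: eqP => [->//|/eqP yx].
  by have := implyP (vw y) yx => /eqP ->.
apply: eq_bigl => c; rewrite ffunE !eqxx andbT; apply/forallP => y.
by apply/implyP => yx; rewrite ffunE (negPf yx).
Qed.

(** Clearing the denominator, invariance becomes the vanishing of a polynomial P
    in t at all natural numbers, so P = 0; its derivative at 0 is the infinitesimal
    invariance. *)
Lemma fixes_inf T : (forall i j t, i != j -> 1 + t ^+ 2 != 0 ->
  fixes T (plane_rotation i j t)) -> lie_invariant setT T.
Proof.
move=> TG i j w ij.
pose p k l : {poly K} :=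
  if k == l then (if (k == i) || (k == j) then 1 - 'X^2 else 1 + 'X^2)
  else if (k == i) && (l == j) then 'X *+ 2
  else if (k == j) && (l == i) then - ('X *+ 2) else 0.
have hE := (hornerD, hornerN, hornerXn, hornerMn, hornerC, hornerX).
(* p k l is the entry (k, l) of a rotation times 1 + t^2. *)
pose P := \sum_(v : word) (\prod_x p (v x) (w x)) * (T v)%:P
  - (1 + 'X^2) ^+ #|I| * (T w)%:P.
have pE t a b : 1 + t ^+ 2 != 0 ->
    (p a b).[t] = (1 + t ^+ 2) * plane_rotation i j t a b.
  move=> t0; rewrite mulrC mxE /p.
  by case: ifP => _; [case: ifP => _|case: ifP => _; [|case: ifP => _]];
    rewrite !hE; field.
have P0 : P = 0.
  apply: poly_nat_eq0 => k; set t := k%:R.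
  have t0 : 1 + t ^+ 2 != 0.
    by rewrite gt_eqF // ltr_pwDl ?exprn_ge0 // ler0n.
  rewrite /P hornerD hornerN horner_sum (eq_bigr (fun v : word =>
     (1 + t ^+ 2) ^+ #|I| * ((\prod_x plane_rotation i j t (v x) (w x)) * T v))).
    by rewrite -mulr_sumr -TG // !hornerE subrr.
  move=> v _; rewrite hornerM hornerC horner_prod mulrA; congr (_ * _).
  rewrite -prodr_const -big_split /=; by apply: eq_bigr => x _; apply: pE.
have p0 a b : (p a b).[0] = (a == b)%:R.
  rewrite /p; case: ifP => _; [case: ifP => _|case: ifP => _; [|case: ifP => _]];
    by rewrite !hornerE ?expr0n /= ?mul0rn ?subr0 ?addr0 ?oppr0.
have dX2 : ('X^2)^`().[0] = 0 :> K by rewrite derivXn hornerMn hornerX mul0rn.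
have dp0 a b : (p a b)^`().[0]
   = 2%:R * (((b == j)%:R * (a == i)%:R) - ((b == i)%:R * (a == j)%:R)).
  have jiF : (j == i) = false by rewrite eq_sym (negPf ij).
  have dX : ('X *+ 2)^`().[0] = 2%:R :> K by rewrite derivMn derivX hornerMn hornerC.
  rewrite /p; have [ab|ab] := eqVneq a b.
    rewrite {}ab.
    have -> : (b == j)%:R * (b == i)%:R = 0 :> K.
      by have [->|] := eqVneq b j; rewrite ?jiF ?mulr0 ?mul0r.
    rewrite [(b == i)%:R * _]mulrC.
    have -> : (b == j)%:R * (b == i)%:R = 0 :> K.
      by have [->|] := eqVneq b j; rewrite ?jiF ?mulr0 ?mul0r.
    by rewrite subrr mulr0; case: ifP => _;
      rewrite ?derivB ?derivD derivC hornerD ?hornerN dX2 hornerC ?oppr0 addr0.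
  have [->|ai] := eqVneq a i.
    rewrite (negPf ij) mulr0 subr0 mulr1 /=.
    case: (b == j); first by rewrite dX mulr1.
    by rewrite derivC hornerC mulr0.
  rewrite mulr0 sub0r /=; have [_|aj] := eqVneq a j => /=.
    rewrite mulr1; case: (b == i); first by rewrite derivN hornerN dX mulrN1.
    by rewrite derivC hornerC oppr0 mulr0.
  by rewrite mulr0 oppr0 mulr0 !derivE hornerC.
have dm : ((1 + 'X^2) ^+ #|I|)^`().[0] = 0 :> K.
  by rewrite deriv_exp hornerMn hornerM derivD derivC add0r dX2 mul0r mul0rn.
have dP x : \sum_(v : word) ((p (v x) (w x))^`() * \prod_(y | y != x) p (v y) (w y)).[0]
      * T v
    = \sum_c (p c (w x))^`().[0] * T (upd w x c).
  rewrite (eq_bigr (fun c => (p (upd w x c x) (w x))^`().[0] * T (upd w x c))); last first.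
    by move=> c _; rewrite ffunE eqxx.
  rewrite -(sum_upd w x (fun v => (p (v x) (w x))^`().[0] * T v)) [RHS]big_mkcond.
  apply: eq_bigr => v _; rewrite hornerM horner_prod; case: ifPn => [/forallP vw|].
    rewrite big1 ?mulr1 // => y yx; rewrite p0.
    by have := implyP (vw y) yx => /eqP ->; rewrite eqxx.
  rewrite negb_forall => /existsP[y]; rewrite negb_imply => /andP[yx vwy].
  by rewrite (bigD1 y) //= p0 (negPf vwy) mul0r mulr0 mul0r.
have : P^`().[0] = 0 by rewrite P0 derivC horner0.
rewrite /P derivB hornerD hornerN derivM derivC mulr0 addr0 hornerM dm mul0r subr0.
rewrite linear_sum horner_sum /=.
rewrite (eq_bigr (fun v : word => \sum_x
   ((p (v x) (w x))^`() * \prod_(y | y != x) p (v y) (w y)).[0] * T v)); last first.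
  move=> v _; rewrite derivM derivC mulr0 addr0 hornerM hornerC.
  by rewrite deriv_prod ?index_enum_uniq // horner_sum mulr_suml.
rewrite exchange_big /= (eq_bigr _ (fun x _ => dP x)).
have E x : \sum_c (p c (w x))^`().[0] * T (upd w x c)
    = - 2%:R * ((w x == i)%:R * T (upd w x j) - (w x == j)%:R * T (upd w x i)).
  rewrite (eq_bigr (fun c => 2%:R * (w x == j)%:R * ((c == i)%:R * T (upd w x c))
     - 2%:R * (w x == i)%:R * ((c == j)%:R * T (upd w x c)))); last first.
    by move=> c _; rewrite dp0; ring.
  have sumt (k : 'I_n) : \sum_c (c == k)%:R * T (upd w x c) = T (upd w x k).
    by rewrite (bigD1 k) //= eqxx mul1r big1 ?addr0 // => c /negPf ->; rewrite mul0r.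
  by rewrite sumrB -!mulr_sumr !sumt; ring.
rewrite (eq_bigr _ (fun x _ => E x)) -mulr_sumr => /eqP.
rewrite mulf_eq0 oppr_eq0 pnatr_eq0 /= => /eqP H.
by rewrite -[RHS]H; apply: eq_bigl => x; rewrite inE.
Qed.

(** The first fundamental theorem of invariant theory for the orthogonal group, in
    dual form.  A sequence s of pairs that uses each index once is a perfect
    matching of the indices. *)
Theorem invariant_matchings_eq0 T :
  (forall i j t, i != j -> 1 + t ^+ 2 != 0 -> fixes T (plane_rotation i j t)) ->
  (forall i, fixes T (coord_reflection i)) ->
  (forall s, perm_eq (ends s) (enum I) -> forall w, contrs s T w = 0) ->
  forall w, T w = 0.
Proof.
move=> /fixes_inf TI /fixes_par TP TM; apply: (lie_invariant_matchings_eq0 TI TP) => s sT.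
by apply: TM; rewrite (perm_trans sT) // enum_setT enumT.
Qed.

End Rotations.
End Tensors.

(** * A matrix model of the exterior algebra *)

(** The sign depends on the two sequences and on the rule e only, not on the ring or
    on the factors: this is what allows reordering inside a sum. *)
Lemma prod_perm_sign (T : eqType) (e : T -> T -> bool) (s t : seq T) :
  perm_eq s t ->
  exists eps : bool, forall (R : pzRingType) (f : T -> R),
    (forall x y, f x * f y = (-1) ^+ e x y * (f y * f x)) ->
    \prod_(x <- s) f x = (-1) ^+ eps * \prod_(x <- t) f x.
Proof.
elim: s t => [|x s IH] t.
  by move/perm_size => /esym/size0nil ->; exists false => R f _; rewrite mul1r.
move=> st; have xt : x \in t by rewrite -(perm_mem st) mem_head.
case/splitPr: xt st => t1 t2 st.
have {}st : perm_eq s (t1 ++ t2).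
  by rewrite -(perm_cons x) (perm_trans st) // -cat1s perm_catCA.
have [eps Heps] := IH _ st.
have [eps' Heps'] : exists eps' : bool, forall (R : pzRingType) (f : T -> R),
    (forall x y, f x * f y = (-1) ^+ e x y * (f y * f x)) ->
    f x * \prod_(y <- t1) f y = (-1) ^+ eps' * (\prod_(y <- t1) f y * f x).
  elim: t1 {IH st Heps} => [|y t1 [e1 He1]].
    by exists false => R f _; rewrite !big_nil mul1r mulr1 mul1r.
  exists (e x y (+) e1) => R f fE; rewrite !big_cons mulrA fE -!mulrA He1 //.
  by rewrite signr_addb -!mulrA; congr (_ * _); rewrite !mulrA commr_sign.
exists (eps (+) eps') => R f fE.
rewrite big_cons (Heps _ _ fE) !big_cat big_cons /= signr_addb -!mulrA.
rewrite [LHS]mulrA (commr_sign (f x) eps) -mulrA; congr (_ * _).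
by rewrite [LHS]mulrA Heps' // -!mulrA.
Qed.

Lemma prod_dup_eq0 (R : pzRingType) (T : eqType) (e : T -> T -> bool) (f : T -> R)
    (s : seq T) :
  (forall x y, f x * f y = (-1) ^+ e x y * (f y * f x)) ->
  (forall x, f x * f x = 0) -> ~~ uniq s -> \prod_(x <- s) f x = 0.
Proof.
move=> fE f0; elim: s => //= x s IH; rewrite negb_and negbK big_cons.
case/orP => [|/IH ->]; last by rewrite mulr0.
elim: s {IH} => //= y s IH; rewrite inE big_cons mulrA.
case: eqP => [->|_] /= xs; first by rewrite f0 mul0r.
by rewrite fE -!mulrA IH // !mulr0.
Qed.

Section JordanWigner.
Variable K : fieldType.

(** The recursion of Jordan and Wigner: the old generators become diag(x, -x), which
    anticommutes with the new generator, the strictly upper triangular block. *)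
Lemma jordan_wigner N : exists D (x : 'I_N -> 'M[K]_D.+1),
  [/\ forall i j, x i *m x j = - (x j *m x i), forall i, x i *m x i = 0
    & \prod_(i < N) x i != 0].
Proof.
elim: N => [|N [D [x [anti sq top]]]].
  exists 0%N, (fun _ => 0); split=> [[]|[]|] //.
  by rewrite big_ord0 oner_neq0.
pose diag (y : 'M[K]_D.+1) : 'M[K]_(D.+1 + D.+1) := block_mx y 0 0 (- y).
pose new : 'M[K]_(D.+1 + D.+1) := block_mx 0 1%:M 0 0.
pose x' (i : 'I_N.+1) : 'M[K]_((D + D.+1).+1) :=
  if unlift ord0 i is Some j then diag (x j) else new.
exists (D + D.+1)%N, x'.
have new_new : new *m new = 0 :> 'M[K]_(D.+1 + D.+1).
  by rewrite mulmx_block !(mulmx0, mul0mx, mulmx1, mul1mx, addr0, add0r) block_mx0.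
have diag_diag y z : diag y *m diag z = block_mx (y *m z) 0 0 (y *m z).
  by rewrite mulmx_block !(mulmx0, mul0mx, mulmx1, mul1mx, addr0, add0r)
    mulNmx mulmxN opprK.
have new_diag y : new *m diag y = block_mx 0 (- y) 0 0.
  by rewrite mulmx_block !(mulmx0, mul0mx, mulmx1, mul1mx, addr0, add0r).
have diag_new y : diag y *m new = block_mx 0 y 0 0.
  by rewrite mulmx_block !(mulmx0, mul0mx, mulmx1, mul1mx, addr0, add0r).
have diag_blk y (a b : 'M[K]_D.+1) :
    diag y *m block_mx a 0 0 b = block_mx (y *m a) 0 0 (- y *m b).
  by rewrite mulmx_block !(mulmx0, mul0mx, addr0, add0r).
have new_blk (a b : 'M[K]_D.+1) : new *m block_mx a 0 0 b = block_mx 0 b 0 0.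
  by rewrite mulmx_block !(mulmx0, mul0mx, mul1mx, addr0, add0r).
split.
- move=> i j; rewrite /x'; case: unliftP => [i' _|_]; case: unliftP => [j' _|_].
  + rewrite [LHS]diag_diag [X in - X]diag_diag anti.
    by rewrite -[RHS](esym (@opp_block_mx K D.+1 D.+1 D.+1 D.+1 _ _ _ _)) oppr0.
  + rewrite [LHS]diag_new [X in - X]new_diag.
    by rewrite -[RHS](esym (@opp_block_mx K D.+1 D.+1 D.+1 D.+1 _ _ _ _)) oppr0 opprK.
  + rewrite [X in - X]diag_new [LHS]new_diag.
    by rewrite -[RHS](esym (@opp_block_mx K D.+1 D.+1 D.+1 D.+1 _ _ _ _)) oppr0.
  + by rewrite [LHS]new_new [X in - X]new_new oppr0.
- move=> i; rewrite /x'; case: unliftP => [i' _|_]; last exact: new_new.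
  by rewrite [LHS]diag_diag sq block_mx0.
rewrite big_ord_recl {1}/x' unlift_none.
have -> : \prod_(i < N) x' (lift ord0 i)
    = block_mx (\prod_(i < N) x i) 0 0 (\prod_(i < N) - x i) :> 'M[K]_(D.+1 + D.+1).
  transitivity (\prod_(i < N) (diag (x i) : 'M[K]_((D + D.+1).+1))).
    by apply: eq_bigr => i _; rewrite /x' liftK.
  elim/big_rec3: _ => [|i y1 y2 y3 _ ->]; last first.
    exact: diag_blk.
  exact: (@scalar_mx_block _ D.+1 D.+1 1).
have -> : new * (block_mx (\prod_(i < N) x i) 0 0 (\prod_(i < N) - x i) :
     'M[K]_((D + D.+1).+1))
  = block_mx 0 (\prod_(i < N) - x i) 0 0 :> 'M[K]_(D.+1 + D.+1).
  exact: new_blk.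
apply: contraNneq top => E; apply/eqP.
have := congr1 (@ursubmx K D.+1 D.+1 D.+1 D.+1) E.
rewrite block_mxKur (_ : ursubmx _ = 0); last by apply/matrixP => i j; rewrite !mxE.
rewrite (prodrN predT) => {}E.
by rewrite -[LHS](signrMK #|'I_N|) E mulr0.
Qed.
End JordanWigner.

Lemma prod_enum (R : pzRingType) (I : finType) (F : I -> R) :
  \prod_(i <- enum I) F i = \prod_i F i.
Proof. by rewrite enumT /index_enum; case: index_enum_key. Qed.

Section WedgeProduct.
Variables (K : numFieldType) (A : algType K).

Lemma prod_slot_linear (I : eqType) (r : seq I) (i : I) (f f1 f2 : I -> A) (c : K) :
  uniq r -> i \in r -> f i = c *: f1 i + f2 i ->
  (forall j, j != i -> f1 j = f j /\ f2 j = f j) ->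
  \prod_(j <- r) f j = c *: \prod_(j <- r) f1 j + \prod_(j <- r) f2 j.
Proof.
elim: r => //= j r IH /andP[jr ur]; rewrite inE => ir fi fj; rewrite !big_cons.
have [ij|nij] := eqVneq j i.
  subst j; rewrite fi mulrDl scalerAl.
  suff E (g : I -> A) : (forall j, j != i -> g j = f j) ->
      \prod_(j <- r) g j = \prod_(j <- r) f j.
    by rewrite !E // => k /fj[].
  move=> gf; apply: eq_big_seq => k kr; apply: gf.
  by apply: contraNneq jr => <-.
have [-> ->] := fj _ nij; rewrite scalerAr -mulrDr; congr (_ * _).
by apply: IH => //; move: ir; rewrite eq_sym (negPf nij).
Qed.

Variables (U : vectType K) (xi : {linear U -> A}).
Hypothesis xi_sq : forall u, xi u * xi u = 0.

Lemma xi_anti u v : xi u * xi v = - (xi v * xi u).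
Proof.
have := xi_sq (u + v); rewrite linearD mulrDl !mulrDr !xi_sq add0r addr0.
by move/eqP; rewrite addr_eq0 => /eqP.
Qed.

Lemma prod_xi_dup (s : seq U) : ~~ uniq s -> \prod_(v <- s) xi v = 0.
Proof.
by apply: (prod_dup_eq0 (e := fun _ _ => true)) => // u v; rewrite xi_anti mulN1r.
Qed.

Definition eval_prod d (u : {ffun 'I_d -> U}) : A := \prod_(a < d) xi (u a).

Lemma eval_prod_multilinear d : multilinear (@eval_prod d).
Proof.
move=> u i c x y; apply: (prod_slot_linear (i := i)).
- exact: index_enum_uniq.
- exact: mem_index_enum.
- by rewrite !ffunE eqxx linearP.
- by move=> j ji; rewrite !ffunE (negPf ji).
Qed.

Lemma eval_prod_alternating d : alternating (@eval_prod d).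
Proof.
move=> u i j ij uij.
have -> : eval_prod u = \prod_(v <- codom u) xi v by rewrite big_map prod_enum.
by apply: prod_xi_dup; apply: contra ij => /injectiveP/(_ _ _ uij) ->.
Qed.

Definition ext_eval d : ext_pow d U -> A := ext_ext (@eval_prod d).

HB.instance Definition _ d := GRing.Linear.copy (@ext_eval d) (ext_ext (@eval_prod d)).

Lemma ext_eval_wedge d (u : {ffun 'I_d -> U}) : ext_eval (wedge u) = \prod_(a < d) xi (u a).
Proof. exact: ext_ext_wedge (@eval_prod_multilinear d) (@eval_prod_alternating d). Qed.

Lemma ext_evalE d (w : ext_pow d U) :
  ext_eval w = \sum_s w s *: \prod_(a < d) xi (basis_vec (val s a)).
Proof.
by apply: eq_bigr => s _; congr (_ *: _); apply: eq_bigr => a _; rewrite ffunE.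
Qed.

(** The coefficient of a monomial is read off by multiplying with the generators
    missing from it: every other monomial of the same degree then repeats one. *)
Lemma ext_eval_inj : \prod_(i < \dim {:U}) xi (basis_vec i) != 0 ->
  forall d (w : ext_pow d U), ext_eval w = 0 -> w = 0.
Proof.
move=> top d w w0; apply/ffunP => s0; rewrite ffunE.
pose P r := \prod_(i <- r) xi (basis_vec i).
have Pdup r : ~~ uniq r -> P r = 0.
  move=> nr; rewrite /P -(big_map (@basis_vec K U) xpredT xi); apply: prod_xi_dup.
  by apply: contra nr => /map_uniq.
have wP : ext_eval w = \sum_s w s *: P (codom (val s)).
  by rewrite ext_evalE; apply: eq_bigr => s _; rewrite /P big_map prod_enum.
pose compl := [seq i <- enum 'I_(\dim {:U}) | i \notin codom (val s0)].
have : ext_eval w * P compl = 0 by rewrite w0 mul0r.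
rewrite wP mulr_suml (bigD1 s0) //= big1 ?addr0 => [|s ss0].
  have /(prod_perm_sign (fun _ _ => true))[eps E] :
      perm_eq (codom (val s0) ++ compl) (enum 'I_(\dim {:U})).
    apply: uniq_perm (enum_uniq _) _; last first.
      by move=> i; rewrite mem_cat mem_filter mem_enum inE andbT orbN.
    rewrite cat_uniq filter_uniq ?enum_uniq // andbT.
    rewrite (map_inj_uniq (increasing_inj (valP s0))) enum_uniq /=.
    by apply/hasPn => i; rewrite mem_filter => /andP[].
  rewrite -scalerAl /P -big_cat /=.
  rewrite (E A) => [/eqP|x y]; last by rewrite expr1 mulN1r xi_anti.
  rewrite scaler_eq0 => /orP[/eqP //|/eqP/(congr1 ( *%R ((-1) ^+ eps)))].
  by rewrite signrMK mulr0 prod_enum /= => /eqP; rewrite (negPf top).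
rewrite -scalerAl /P -big_cat -/(P _) Pdup ?scaler0 //.
apply: contra ss0 => us; apply/eqP/val_inj/increasing_eq; try exact: valP.
move=> a; have : val s a \notin compl.
  move: us; rewrite cat_uniq => /and3P[_ /hasPn H _].
  by apply/negP => /H; rewrite codom_f.
by rewrite mem_filter mem_enum andbT negbK => /codomP.
Qed.

End WedgeProduct.

(** Multiplicative computations in the exterior algebra are made in this matrix
    algebra, into which all the exterior powers embed compatibly with products. *)
Lemma exterior_model (K : numFieldType) (U : vectType K) :
  exists D (xi : {linear U -> 'M[K]_D.+1}), (forall u, xi u * xi u = 0) /\
    forall d (w : ext_pow d U), ext_eval xi w = 0 -> w = 0.
Proof.
have [D [x [anti sq top]]] := jordan_wigner K (\dim {:U}).
pose f (u : U) := \sum_i cd i u *: x i.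
have fL : linear f.
  move=> c u v; rewrite /f scaler_sumr -big_split /=; apply: eq_bigr => i _.
  by rewrite cd_linear scalerDl scalerA.
pose xi : {linear U -> 'M[K]_D.+1} := HB.pack f (GRing.isLinear.Build K U _ _ f fL).
have xi_basis i : xi (basis_vec i) = x i.
  rewrite /= /f (bigD1 i) //= big1 => [|j ji]; rewrite cd_basis ?eqxx ?scale1r ?addr0 //.
  by rewrite (negPf ji) scale0r.
have xi_sq u : xi u * xi u = 0.
  pose g i j := (cd i u *: x i) * (cd j u *: x j).
  have gC i j : g i j = - g j i.
    rewrite /g -!scalerAl -!scalerAr !scalerA [x i * x j]anti.
    by rewrite scalerN [cd i u * _]mulrC.
  have S : xi u * xi u = \sum_i \sum_j g i j.
    by rewrite /= /f mulr_suml; apply: eq_bigr => i _; rewrite mulr_sumr.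
  have : xi u * xi u *+ 2 = 0.
    rewrite mulr2n {1}S exchange_big /= S -big_split big1 //= => i _.
    by rewrite -big_split big1 //= => j _; rewrite gC addNr.
  by rewrite -scaler_nat => /eqP; rewrite scaler_eq0 pnatr_eq0 => /eqP.
exists D, xi; split=> // d w; apply: ext_eval_inj => //.
by under eq_bigr => i _ do rewrite xi_basis.
Qed.

(** * Matrices with anticommuting entries *)

Lemma deriv_det (R : comNzRingType) (n : nat) (M : 'M[{poly R}]_n) :
  (\det M)^`() = \sum_i \det (\matrix_(k, l) if k == i then (M k l)^`() else M k l).
Proof.
rewrite /determinant linear_sum [RHS]exchange_big /=; apply: eq_bigr => s _.
rewrite -mulr_sumr.
have signD (p : {poly R}) : ((-1) ^+ s * p)^`() = (-1) ^+ s * p^`().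
  by case: (s : bool); rewrite ?expr1 ?mulN1r ?derivN ?expr0 ?mul1r.
rewrite signD deriv_prod ?index_enum_uniq //; congr (_ * _); apply: eq_bigr => i _.
rewrite [RHS](bigD1 i) //= mxE eqxx; congr (_ * _).
by apply: eq_bigr => k ki; rewrite mxE (negPf ki).
Qed.

(** The formula of Jacobi for the derivative of a determinant, at X - Y. *)
Lemma deriv_char_poly (R : comNzRingType) (n : nat) (Y : 'M[R]_n) :
  (char_poly Y)^`() = \tr (\adj (char_poly_mx Y)).
Proof.
rewrite /char_poly deriv_det; apply: eq_bigr => i _; rewrite [RHS]mxE.
rewrite (expand_det_row _ i) (bigD1 i) //= big1 ?addr0 => [|j ji].
  rewrite !mxE eqxx derivB derivX derivC subr0 mul1r; congr (_ * \det _).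
  by apply/matrixP => k l; rewrite !mxE eq_sym (negPf (neq_lift _ _)).
by rewrite !mxE eqxx eq_sym (negPf ji) derivB !derivC subr0 mul0r.
Qed.

(** Newton's identities in matrix form.  The coefficients B_k of the adjugate of
    X - Y satisfy B_k = Y B_(k+1) + c_(k+1), where c_k are the coefficients of the
    characteristic polynomial.  If the powers of Y have trace 0, then so has
    Y B_(k+1), and tr B_k is (n+1) c_(k+1) by this recursion but (k+1) c_(k+1) by
    the formula of Jacobi.  So the characteristic polynomial is a power of X. *)
Lemma trace_powers_nilpotent (R : comNzRingType) (n : nat) (Y : 'M[R]_n.+1) :
  (forall (x : R) (k : nat), x *+ k.+1 = 0 -> x = 0) ->
  (forall k, \tr (Y ^+ k.+1) = 0) -> Y ^+ n.+1 = 0.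
Proof.
move=> torsion_free trY; pose chi := char_poly Y.
pose adj := \adj (char_poly_mx Y).
pose B k : 'M[R]_n.+1 := \matrix_(i, j) (adj i j)`_k.
have eqX i j : adj i j * 'X = \sum_l (Y i l)%:P * adj l j + chi *+ (i == j).
  have := congr1 (fun M : 'M[{poly R}]_n.+1 => M i j) (mul_mx_adj (char_poly_mx Y)).
  rewrite !mxE -/chi => <-; rewrite -big_split /= (bigD1 i) //= !mxE eqxx.
  rewrite big1 => [|l li].
    by rewrite addr0 -mulrDl mulr1n [_ + ('X - _)]addrC subrK mulrC.
  by rewrite !mxE eq_sym (negPf li) sub0r mulNr subrr.
have trAdj : chi^`() = \tr adj := deriv_char_poly Y.
clearbody adj.
have BE k : B k = Y *m B k.+1 + (chi`_k.+1)%:M.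
  apply/matrixP => i j; rewrite !mxE.
  have := congr1 (fun p : {poly R} => p`_k.+1) (eqX i j).
  rewrite coefMX /= => ->; rewrite coefD coef_sum coefMn; congr (_ + _).
  by apply: eq_bigr => l _; rewrite coefCM !mxE.
have B0 : Y *m B 0 + (chi`_0)%:M = 0.
  apply/matrixP => i j; rewrite !mxE.
  have := congr1 (fun p : {poly R} => p`_0) (eqX i j).
  rewrite coefMX /= => E; rewrite [RHS]E coefD coefMn.
  rewrite [(\sum_l (Y i l)%:P * adj l j)`_0]coef_sum; congr (_ + _).
  by apply: eq_bigr => l _; rewrite coefCM !mxE.
have Bbig : exists N, forall k, (N <= k)%N -> B k = 0.
  exists (\max_i \max_j size (adj i j)) => k Nk; apply/matrixP => i j; rewrite !mxE.
  apply: nth_default; apply: leq_trans Nk.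
  by apply: leq_trans (leq_bigmax i); apply: (leq_bigmax (F := fun j => size (adj i j)) j).
have trYB j k : \tr (Y ^+ j.+1 *m B k) = 0.
  have [N BN] := Bbig.
  have [m] : exists m, (N <= k + m)%N by exists N; rewrite leq_addl.
  elim: m => [|m IH] in j k *; first by rewrite addn0 => /BN ->; rewrite mulmx0 mxtrace0.
  rewrite -addSnnS => /IH H; rewrite BE mulmxDr mulmxA mxtraceD.
  rewrite [Y ^+ _ *m Y](_ : _ = Y ^+ j.+2); last by rewrite [RHS]exprSr.
  by rewrite H add0r mul_mx_scalar mxtraceZ trY mulr0.
have trB k : \tr (B k) = chi`_k.+1 *+ n.+1.
  by rewrite BE mxtraceD -[Y in Y *m _]expr1 trYB add0r mxtrace_scalar.
have chi' k : \tr (B k) = chi`_k.+1 *+ k.+1.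
  rewrite -coef_deriv trAdj /mxtrace coef_sum.
  by apply: eq_bigr => i _; rewrite mxE.
have chi_small k : (k < n.+1)%N -> chi`_k = 0.
  case: k => [_|k kn].
    apply: (torsion_free _ n); rewrite -mxtrace_scalar.
    have := congr1 mxtrace B0; rewrite mxtraceD mxtrace0.
    by rewrite -[Y in Y *m _]expr1 trYB add0r.
  apply: (torsion_free _ (n - k.+1)%N).
  rewrite -subSn ?mulrnBr -?chi' -?trB ?subrr // ltnW //.
have -> : Y ^+ n.+1 = horner_mx Y chi.
  suff -> : chi = 'X^(n.+1) by rewrite rmorphXn /= horner_mx_X.
  apply/polyP => k; rewrite coefXn; have [->|kn] := eqVneq k n.+1.
    have := monicP (char_poly_monic Y).
    by rewrite lead_coefE size_char_poly.
  have [/chi_small //|nk] := ltnP k n.+1.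
  by rewrite nth_default // size_char_poly ltn_neqAle eq_sym kn.
exact: Cayley_Hamilton.
Qed.

Section DoubleCentralizer.
Variables (A : nzRingType) (S : A -> Prop).
Hypothesis SC : forall x y, S x -> S y -> x * y = y * x.

(** The bicentralizer of a family of commuting elements is a commutative subring
    that contains it, so results on matrices over commutative rings apply. *)
Definition bicentralizer : pred A :=
  fun x => `[< forall z, (forall y, S y -> z * y = y * z) -> x * z = z * x >].

Fact bicentralizer_subring : subring_closed bicentralizer.
Proof.
split.
- by apply/asboolP => z _; rewrite mul1r mulr1.
- move=> x y /asboolP xz /asboolP yz; apply/asboolP => z Sz.
  by rewrite mulrBl mulrBr xz // yz.
- move=> x y /asboolP xz /asboolP yz; apply/asboolP => z Sz.
  by rewrite -mulrA yz // mulrA xz // mulrA.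
Qed.

HB.instance Definition _ :=
  GRing.isSubringClosed.Build A bicentralizer bicentralizer_subring.

Record bicent := Bicent { bicent_val : A; _ : bicent_val \in bicentralizer }.

HB.instance Definition _ := [isSub for bicent_val].
HB.instance Definition _ := [Choice of bicent by <:].
HB.instance Definition _ := [SubChoice_isSubNzRing of bicent by <:].

Lemma mem_bicentralizer x : S x -> x \in bicentralizer.
Proof. by move=> Sx; apply/asboolP => z /(_ x Sx). Qed.

Lemma bicentralizerC x y : x \in bicentralizer -> y \in bicentralizer -> x * y = y * x.
Proof.
move=> /asboolP xz /asboolP yz; apply: xz => z Sz; apply: yz => t St.
exact: SC.
Qed.

Lemma bicent_mulC : commutative (@GRing.mul bicent).
Proof.
by move=> x y; apply/val_inj; rewrite !rmorphM /= bicentralizerC //; apply: valP.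
Qed.
End DoubleCentralizer.

Lemma commuting_trace_powers_nilpotent (A : nzRingType) (n : nat) (Y : 'M[A]_n) :
  (forall (x : A) (k : nat), x *+ k.+1 = 0 -> x = 0) ->
  (forall i j k l, Y i j * Y k l = Y k l * Y i j) ->
  (forall k, \tr (Y ^+ k.+1) = 0) -> Y ^+ n = 0.
Proof.
move=> tf YC trY; case: n => [|n] in Y YC trY *.
  by apply/matrixP => [[]].
pose S (x : A) := exists i j, x = Y i j.
have SC x y : S x -> S y -> x * y = y * x by move=> [i [j ->]] [k [l ->]].
pose R : comNzRingType :=
  HB.pack (bicent S) (GRing.PzRing_hasCommutativeMul.Build (bicent S) (bicent_mulC SC)).
have inS i j : Y i j \in bicentralizer S by apply: mem_bicentralizer; exists i, j.
pose Y' : 'M[R]_n.+1 := \matrix_(i, j) (Bicent (inS i j) : bicent S).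
pose f : {rmorphism R -> A} := (val : {rmorphism bicent S -> A}).
have fI : injective f by exact: val_inj.
have fY : map_mx f Y' = Y by apply/matrixP => i j; rewrite !mxE.
have fX k : map_mx f (Y' ^+ k) = Y ^+ k.
  elim: k => [|k IH]; first exact: map_mx1.
  by rewrite !exprS -IH -[in RHS]fY; exact: map_mxM.
rewrite -fX (_ : Y' ^+ n.+1 = 0) ?map_mx0 //.
apply: trace_powers_nilpotent => [x k xk|k]; apply: fI; rewrite rmorph0.
  by apply: (tf _ k); rewrite -rmorphMn xk rmorph0.
by rewrite -trace_map_mx fX trY.
Qed.

Section OddMatrix.
Variables (K : numFieldType) (A : algType K) (n : nat) (X : 'M[A]_n).
Hypothesis XC : forall i j k l, X i j * X k l = - (X k l * X i j).
Hypothesis XT : forall i j, X i j = X j i.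

Lemma alg_torsion_free (x : A) k : x *+ k.+1 = 0 -> x = 0.
Proof. by rewrite -scaler_nat => /eqP; rewrite scaler_eq0 pnatr_eq0 => /eqP. Qed.

Lemma mxXS k i j : (X ^+ k.+1) i j = \sum_l X i l * (X ^+ k) l j.
Proof. by rewrite exprS mxE. Qed.

Lemma mxXSr k i j : (X ^+ k.+1) i j = \sum_l (X ^+ k) i l * X l j.
Proof. by rewrite exprSr mxE. Qed.

(** Each entry of X^k is a sum of products of k entries of X, past each of which z
    moves with the sign (-1)^e. *)
Lemma pow_comm z e : (forall i j, z * X i j = (-1) ^+ e * (X i j * z)) ->
  forall k i j, z * (X ^+ k) i j = (-1) ^+ (e * k) * ((X ^+ k) i j * z).
Proof.
move=> zX; elim=> [|k IH] i j.
  by rewrite muln0 !expr0 mul1r !mxE; apply: commr_nat.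
rewrite mxXS mulr_sumr mulr_suml mulr_sumr; apply: eq_bigr => l _.
rewrite mulrA zX -!mulrA IH mulnS exprD -!mulrA; congr (_ * _).
by rewrite [LHS]mulrA (commr_sign (X i l)) -mulrA.
Qed.

Lemma entry_comm k l i j p q :
  (X ^+ k) i j * (X ^+ l) p q = (-1) ^+ (k * l) * ((X ^+ l) p q * (X ^+ k) i j).
Proof.
apply: pow_comm => {}p {}q.
have -> : X p q * (X ^+ k) i j = (-1) ^+ k * ((X ^+ k) i j * X p q).
  have := @pow_comm (X p q) 1 _ k i j; rewrite mul1n; apply=> *.
  by rewrite expr1 mulN1r XC.
by rewrite signrMK.
Qed.

(** Transposing X^k reverses products of k anticommuting factors, which is a
    permutation with binomial(k, 2) inversions. *)
Lemma pow_sym k i j : (X ^+ k) i j = (-1) ^+ 'C(k, 2) * (X ^+ k) j i.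
Proof.
elim: k i j => [|k IH] i j; first by rewrite mul1r !expr0 !mxE eq_sym.
rewrite mxXS mxXSr mulr_sumr; apply: eq_bigr => l _.
have := entry_comm 1 k i l j l; rewrite mul1n expr1 => E.
rewrite IH mulrA (commr_sign (X i l)) -mulrA E binS bin1 exprD -!mulrA XT.
by congr (_ * (_ * _)).
Qed.

Definition ptrace k : A := \tr (X ^+ k).

Lemma ptrace_comm k l :
  ptrace k * ptrace l = (-1) ^+ odd (k * l) * (ptrace l * ptrace k).
Proof.
transitivity (\sum_i \sum_j (X ^+ k) i i * (X ^+ l) j j).
  by rewrite mulr_suml; apply: eq_bigr => i _; rewrite mulr_sumr.
rewrite exchange_big signr_odd /= mulr_suml mulr_sumr; apply: eq_bigr => j _.
by rewrite !mulr_sumr; apply: eq_bigr => i _; rewrite entry_comm.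
Qed.

Lemma eq_opp_eq0 (x : A) : x = - x -> x = 0.
Proof.
by move/eqP; rewrite -addr_eq0 -mulr2n => /eqP/alg_torsion_free.
Qed.

Lemma ptrace_sym k : odd 'C(k, 2) -> ptrace k = 0.
Proof.
move=> kodd; apply: eq_opp_eq0; rewrite -sumrN; apply: eq_bigr => i _.
by rewrite {1}pow_sym -signr_odd kodd expr1 mulN1r.
Qed.

Lemma ptrace_even k : odd k -> ptrace k.+1 = 0.
Proof.
move=> kodd; apply: eq_opp_eq0; rewrite {1}/ptrace /mxtrace.
rewrite (eq_bigr (fun i => \sum_l X i l * (X ^+ k) l i)); last first.
  by move=> i _; rewrite mxXS.
rewrite exchange_big -sumrN /=; apply: eq_bigr => l _.
rewrite mxXSr -sumrN; apply: eq_bigr => i _.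
by have := entry_comm 1 k i l l i; rewrite mul1n -signr_odd kodd !expr1 mulN1r.
Qed.

(** The entries of X^2 commute and its positive powers, being even powers of X, have
    trace 0. *)
Lemma pow_eq0 k : (n.*2 <= k)%N -> X ^+ k = 0.
Proof.
move=> nk; rewrite -(subnKC nk) exprD -muln2 mulnC exprM.
rewrite commuting_trace_powers_nilpotent ?mul0r //.
- exact: alg_torsion_free.
- by move=> i j p q; rewrite entry_comm -signr_odd expr0 mul1r.
- by move=> l; rewrite -exprM mulnS; apply: ptrace_even; rewrite oddS oddM.
Qed.

Lemma ptrace_neq0 k : (0 < k)%N -> ptrace k != 0 ->
  exists j : 'I_(uphalf n), k = (4 * j).+1.
Proof.
move=> k0 tk.
have kn : (k < n.*2)%N.
  by rewrite ltnNge; apply: contraNN tk => /pow_eq0; rewrite /ptrace => ->; rewrite mxtrace0.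
have kodd : odd k.
  by apply: contraNT tk; case: (k) k0 => //= l _; rewrite negbK => /ptrace_even ->.
have k4 : ~~ odd 'C(k, 2) by apply: contraNN tk => /ptrace_sym ->.
have kE : k = (4 * (k %/ 4)).+1.
  have := divn_eq k 4; have := ltn_pmod k (isT : (0 < 4)%N).
  move: (k %/ 4)%N (k %% 4)%N => q r r4 kE.
  have q4 : odd (q * 4) = false by rewrite oddM andbF.
  case: r r4 kE => [|[|[|[|//]]]] _ kE; rewrite kE in kodd k4 *.
  - by rewrite oddD q4 in kodd.
  - by rewrite mulnC addn1.
  - by rewrite oddD q4 in kodd.
  have E : 'C(q * 4 + 3, 2) = ((q * 4 + 3) * (q * 2 + 1))%N.
    have E : ((q * 4 + 3) * (q * 4 + 3).-1 = ((q * 4 + 3) * (q * 2 + 1)).*2)%N.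
      by rewrite !addnS /= -muln2; nia.
    by rewrite bin2 E doubleK.
  by move: k4; rewrite E oddM !oddD q4 oddM andbF.
have jn : (k %/ 4 < uphalf n)%N by rewrite kE in kn; lia.
by exists (Ordinal jn).
Qed.

End OddMatrix.

(** * Contracting products of entries to products of traces *)

Section Contraction.
Variables (K : numFieldType) (A : algType K) (n : nat) (X : 'M[A]_n).
Hypothesis XC : forall i j k l, X i j * X k l = - (X k l * X i j).
Hypothesis XT : forall i j, X i j = X j i.
Variable I : finType.
Local Notation word := {ffun I -> 'I_n}.
Implicit Types (L : seq (nat * I * I)) (w : word).

(** A triple (k, x, y) stands for the entry of X^k whose row and column are the
    letters of the word at x and y. *)
Definition chain L w : A := \prod_(p <- L) (X ^+ p.1.1) (w p.1.2) (w p.2).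

Definition labels L : seq I := flatten [seq [:: p.1.2; p.2] | p <- L].

Definition degree L : nat := sumn [seq p.1.1 | p <- L].

Lemma perm_labels L L' : perm_eq L L' -> perm_eq (labels L) (labels L').
Proof. by move=> LL'; apply: perm_flatten; apply: perm_map. Qed.

Lemma chain_front a L : a \in labels L -> all (fun p => 0 < p.1.1)%N L ->
  exists (eps : bool) k c L1,
  [/\ forall w, chain L w = (-1) ^+ eps * ((X ^+ k) (w c) (w a) * chain L1 w),
      perm_eq (labels L) [:: a, c & labels L1],
      (0 < k)%N, all (fun p => 0 < p.1.1)%N L1 & degree L = (k + degree L1)%N].
Proof.
case/flattenP => _ /mapP[p pL ->] ap Lpos.
move: (rem p L) (perm_to_rem pL) => L1 perm.
have [eps epsP] := prod_perm_sign (fun p q : nat * I * I => odd (p.1.1 * q.1.1)) perm.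
have {}epsP w : chain L w
    = (-1) ^+ eps * ((X ^+ p.1.1) (w p.1.2) (w p.2) * chain L1 w).
  rewrite /chain (epsP A (fun p => (X ^+ p.1.1) (w p.1.2) (w p.2))) ?big_cons //.
  by move=> q r; rewrite signr_odd entry_comm.
have /= /andP[ppos L1pos] : all (fun p => 0 < p.1.1)%N (p :: L1).
  by rewrite -(perm_all _ perm).
have degE : degree L = (p.1.1 + degree L1)%N.
  by rewrite /degree !sumnE !big_map (perm_big _ perm) big_cons.
have labE := perm_labels perm; rewrite [labels (p :: L1)]/= in labE.
case: p ap perm epsP ppos degE labE {pL L1pos} (L1pos) =>
  [[k x] y] /= ap _ epsP k0 degE labE L1pos.
move: ap; rewrite !inE => /orP[/eqP ->|/eqP ->].
  (* The label a is the row of its factor: transpose. *)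
  exists (eps (+) odd 'C(k, 2)), k, y, L1; split=> // w.
  by rewrite epsP (pow_sym XC XT) signr_addb signr_odd -!mulrA.
exists eps, k, x, L1; split=> //.
by apply: (perm_trans labE); apply/permPl/(perm_catCA [:: x] [:: y]).
Qed.

Lemma chain_upd L w a c : a \notin labels L -> chain L (upd w a c) = chain L w.
Proof.
elim: L => [|p L IH]; first by rewrite /chain !big_nil.
rewrite [labels _]/= !inE !negb_or => /and3P[ap ap' aL].
rewrite /chain !big_cons -!/(chain _ _) IH // !ffunE.
by rewrite eq_sym (negPf ap) eq_sym (negPf ap').
Qed.

(** If a and b are the two ends of one factor X^k, the contraction turns it into the
    trace of X^k; otherwise it joins two factors X^k and X^l into X^(k+l). *)
Lemma contr_chain a b L : uniq (labels L) -> a != b ->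
  a \in labels L -> b \in labels L -> all (fun p => 0 < p.1.1)%N L ->
  exists (eps : bool) ks L',
  [/\ forall w, contr a b (chain L) w
        = (-1) ^+ eps * (\prod_(k <- ks) ptrace X k * chain L' w),
      perm_eq (labels L) [:: a, b & labels L'],
      all (leq 1) ks, all (fun p => 0 < p.1.1)%N L'
    & degree L = (sumn ks + degree L')%N].
Proof.
move=> Lu ab aL bL Lpos.
have [eps [k [c [L1 [LE Lperm k0 L1pos Ldeg]]]]] := chain_front aL Lpos.
have := Lu; rewrite (perm_uniq Lperm) /= inE negb_or -andbA.
case/and4P => ac aL1 cL1 L1u.
have [cb|cb] := eqVneq c b.
  rewrite {}cb in LE Lperm cL1.
  exists eps, [:: k], L1; rewrite /= addn0 andbT; split=> // w.
  rewrite /contr big_seq1 /ptrace /mxtrace mulr_suml mulr_sumr.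
  apply: eq_bigr => v _; rewrite LE !ffunE (negPf ab) !eqxx.
  by rewrite !chain_upd.
have bL1 : b \in labels L1.
  by move: bL; rewrite (perm_mem Lperm) !inE eq_sym (negPf ab) eq_sym (negPf cb).
have [eps' [l [e [L2 [L1E L1perm l0 L2pos L1deg]]]]] := chain_front bL1 L1pos.
have := L1u; rewrite (perm_uniq L1perm) /= inE negb_or -andbA.
case/and4P => be bL2 eL2 L2u.
move: aL1 cL1; rewrite !(perm_mem L1perm) !inE !negb_or.
move=> /and3P[_ ae aL2] /and3P[_ ce cL2].
exists (eps (+) eps' (+) odd 'C(l, 2)), [::], (((k + l)%N, c, e) :: L2).
rewrite /= addn_gt0 k0 L2pos; split=> //.
- move=> w; rewrite big_nil mul1r [chain (_ :: _) w]/chain big_cons -/(chain L2 w) /=.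
  have -> : (X ^+ (k + l)) (w c) (w e) = \sum_v (X ^+ k) (w c) v * (X ^+ l) v (w e).
    by rewrite exprD mxE.
  rewrite mulr_suml mulr_sumr /contr; apply: eq_bigr => v _.
  have neq (x y : I) : x != y -> (y == x) = false by rewrite eq_sym => /negPf.
  rewrite LE L1E !ffunE (negPf ab) !eqxx (neq _ _ ac) (negPf cb).
  rewrite (neq _ _ ae) (neq _ _ be) !chain_upd //.
  rewrite (pow_sym XC XT l) !signr_addb signr_odd -!mulrA; congr (_ * _).
  rewrite [LHS]mulrA (commr_sign ((X ^+ k) _ _)) -mulrA; congr (_ * _).
  by rewrite [LHS]mulrA (commr_sign ((X ^+ k) _ _)) -mulrA.
- apply: (perm_trans Lperm); rewrite perm_cons.
  have := perm_cat (perm_refl [:: c]) L1perm; move/perm_trans; apply.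
  exact/permPl/(perm_catCA [:: c] [:: b]).
- by rewrite Ldeg L1deg add0n addnA.
Qed.

Lemma contrs_chain s L : uniq (labels L) -> perm_eq (labels L) (ends s) ->
  all (fun p => 0 < p.1.1)%N L ->
  exists (eps : bool) ks, [/\ forall w, contrs s (chain L) w
      = (-1) ^+ eps * \prod_(k <- ks) ptrace X k,
    all (leq 1) ks & degree L = sumn ks].
Proof.
elim: s L => [|[a b] s IH] L Lu Lperm Lpos.
  have L0 : L = [::].
    by case: L Lperm {Lu Lpos} => // p L /perm_size.
  by exists false, [::]; rewrite L0; split=> // w; rewrite /= /chain !big_nil mulr1.
have ab : a != b.
  by move: Lu; rewrite (perm_uniq Lperm) ends_cons /= inE negb_or => /and3P[/andP[]].
have aL : a \in labels L by rewrite (perm_mem Lperm) mem_head.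
have bL : b \in labels L by rewrite (perm_mem Lperm) ends_cons !inE eqxx orbT.
have [eps [ks [L' [LE L'perm kspos L'pos Ldeg]]]] := contr_chain Lu ab aL bL Lpos.
have L's : perm_eq (labels L') (ends s).
  have : perm_eq [:: a, b & labels L'] (ends ((a, b) :: s)).
    by rewrite perm_sym in L'perm; apply: perm_trans Lperm.
  by rewrite ends_cons !perm_cons.
have L'u : uniq (labels L').
  by move: Lu; rewrite (perm_uniq L'perm) /= => /and3P[].
have [eps' [ks' [IHE ks'pos L'deg]]] := IH _ L'u L's L'pos.
exists (eps (+) eps'), (ks ++ ks'); split=> [w||].
- rewrite /= (contrs_eq s LE) /=.
  pose c := (-1) ^+ eps * \prod_(k <- ks) ptrace X k.
  transitivity (contrs s ( *%R c \o chain L') w).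
    by apply: contrs_eq => v; rewrite /= mulrA.
  rewrite contrs_morph => [|F]; last by rewrite mulr_sumr.
  rewrite IHE /c big_cat signr_addb -!mulrA; congr (_ * _).
  by rewrite mulrA (commr_sign (\prod_(k <- ks) _)) -mulrA.
- by rewrite all_cat kspos.
- by rewrite Ldeg L'deg sumn_cat.
Qed.

Definition trace_monomial (Z : 'M[A]_n) (S : {set 'I_(uphalf n)}) : A :=
  \prod_(j <- enum S) \tr (Z ^+ (4 * j).+1).

(** Repeated factors give 0, since the surviving traces have odd degree and
    anticommute; the others can be sorted at the cost of a sign. *)
Lemma ptrace_prod ks : all (leq 1) ks ->
  \prod_(k <- ks) ptrace X k = 0 \/
  exists (eps : bool) (S : {set 'I_(uphalf n)}),
    \prod_(k <- ks) ptrace X k = (-1) ^+ eps * trace_monomial X S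
    /\ (\sum_(j in S) (4 * j).+1)%N = sumn ks.
Proof.
move=> kspos.
have [/hasP[k kks /eqP tk]|/hasPn ks0] := boolP (has (fun k => ptrace X k == 0) ks).
  left; case/splitPr: kks => ks1 ks2.
  by rewrite big_cat big_cons /= tk mul0r mulr0.
have [js ksE] : exists js : seq 'I_(uphalf n), ks = [seq (4 * val j).+1 | j <- js].
  elim: ks kspos ks0 => [|k ks IH] /=; first by exists [::].
  move=> /andP[k0 kspos] ks0.
  have [j ->] := ptrace_neq0 XC XT k0 (ks0 k (mem_head _ _)).
  have [|js ->] := IH kspos; last by exists (j :: js).
  by move=> l lks; apply: ks0; rewrite inE lks orbT.
pose f (j : 'I_(uphalf n)) := ptrace X (4 * j).+1.
have fE (i j : 'I_(uphalf n)) : f i * f j = (-1) ^+ true * (f j * f i).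
  by rewrite /f (ptrace_comm XC) oddM /= !oddM.
rewrite ksE big_map; have [js_u|js_u] := boolP (uniq js); last first.
  left; apply: (prod_dup_eq0 (e := fun _ _ => true) (f := f)) => // j.
  by apply: eq_opp_eq0; rewrite [LHS]fE expr1 mulN1r.
right; pose S := [set j in js].
have jsS : perm_eq js (enum S).
  by apply: uniq_perm; rewrite ?enum_uniq // => j; rewrite mem_enum inE.
have [eps epsP] := prod_perm_sign (fun _ _ => true) jsS.
exists eps, S; split; first exact: (epsP A f).
by rewrite sumnE big_map (perm_big _ jsS) big_enum.
Qed.

End Contraction.

(** * Trace monomials as invariants, and their duals *)

Section Functoriality.
Variable K : fieldType.
Implicit Types U V W : vectType K.

Lemma ext_mapE d U V (f : 'Hom(U, V)) (w : ext_pow d U) :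
  ext_map d f w = \sum_s w s *: wedge [ffun a => f (basis_vec (val s a))].
Proof.
rewrite lfunE /=; apply: eq_bigr => s _; congr (_ *: wedge _).
by apply/ffunP => a; rewrite !ffunE.
Qed.

Lemma sym2_mapE U V (f : 'Hom(U, V)) (w : sym2 U) :
  sym2_map f w = \sum_p w p *: sprod (f (basis_vec (val p).1)) (f (basis_vec (val p).2)).
Proof. by rewrite lfunE. Qed.

Lemma ext_map_id d U (f : 'End(U)) : f =1 id -> ext_map d f =1 id.
Proof.
move=> fI w; rewrite [RHS]ext_expand ext_mapE; apply: eq_bigr => s _.
by congr (_ *: wedge _); apply/ffunP => a; rewrite !ffunE fI.
Qed.

Lemma sym2_map_id U (f : 'End(U)) : f =1 id -> sym2_map f =1 id.
Proof.
by move=> fI w; rewrite [RHS]sym2_expand sym2_mapE; apply: eq_bigr => p _; rewrite !fI.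
Qed.

Lemma ext_map_comp d U V W (f : 'Hom(U, V)) (g : 'Hom(V, W)) (h : 'Hom(U, W)) :
  (forall u, h u = g (f u)) -> forall w, ext_map d h w = ext_map d g (ext_map d f w).
Proof.
move=> hE w; rewrite ext_mapE (ext_mapE f) linear_sum; apply: eq_bigr => s _.
rewrite linearZ /= ext_map_wedge; congr (_ *: wedge _).
by apply/ffunP => a; rewrite !ffunE.
Qed.

Lemma sym2_map_comp U V W (f : 'Hom(U, V)) (g : 'Hom(V, W)) (h : 'Hom(U, W)) :
  (forall u, h u = g (f u)) -> forall w, sym2_map h w = sym2_map g (sym2_map f w).
Proof.
move=> hE w; rewrite sym2_mapE (sym2_mapE f) linear_sum; apply: eq_bigr => s _.
by rewrite linearZ /= sym2_map_sprod !hE.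
Qed.

Lemma wedge_expand d U (Q : finType) (c : 'I_d -> Q -> K) (x : Q -> U) :
  wedge [ffun a => \sum_q c a q *: x q]
  = \sum_(f : {ffun 'I_d -> Q}) (\prod_a c a (f a)) *: wedge [ffun a => x (f a)].
Proof.
apply/ffunP => s; rewrite sum_ffunE !ffunE /determinant.
transitivity (\sum_(t : 'S_d) \sum_(f : {ffun 'I_d -> Q}) (-1) ^+ t *
    \prod_a (c a (f a) * cd (val s (t a)) (x (f a)))).
  apply: eq_bigr => t _; rewrite -mulr_sumr; congr (_ * _).
  rewrite -(bigA_distr_bigA (fun a q => c a q * cd (val s (t a)) (x q))).
  apply: eq_bigr => a _; rewrite mxE ffunE /cd linear_sum.
  by apply: eq_bigr => q _; rewrite linearZ.
rewrite exchange_big /=; apply: eq_bigr => f _; rewrite !ffunE /GRing.scale /= mulr_sumr.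
apply: eq_bigr => t _; rewrite mulrCA; congr (_ * _); rewrite big_split /=; congr (_ * _).
by apply: eq_bigr => a _; rewrite mxE ffunE.
Qed.

End Functoriality.

Section Link.
Variables (K : numFieldType) (n : nat).
Local Notation V := ('cV[K]_n : vectType K).
Local Notation U := (sym2 V).
Local Notation act d g := (ext_sym2_act K n d g).

Definition cbasis (i : 'I_n) : 'cV[K]_n := delta_mx i 0.

Lemma cbasis_expand (x : 'cV[K]_n) : x = \sum_i x i 0 *: cbasis i.
Proof.
apply/colP => i; rewrite summxE (bigD1 i) //= big1 ?addr0 => [|j ji].
  by rewrite !mxE eqxx mulr1.
by rewrite !mxE eq_sym (negPf ji) mulr0.
Qed.

(** Both orders of the indices are allowed; the tensors below are indexed by words
    in the letters 'I_n, without any ordering condition. *)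
Definition monom2 (q : 'I_n * 'I_n) : U := sprod (cbasis q.1) (cbasis q.2).

Lemma sprod_expand (x y : V) :
  sprod x y = \sum_(q : 'I_n * 'I_n) (x q.1 0 * y q.2 0) *: monom2 q.
Proof.
rewrite -(pair_bigA _ (fun k l => (x k 0 * y l 0) *: sprod (cbasis k) (cbasis l))) /=.
have sL z : linear (fun x => @sprod K V x z) by move=> c u v; rewrite sprod_linear.
rewrite [x in LHS]cbasis_expand (linear_expand _ _ (sL y)); apply: eq_bigr => k _.
rewrite sprodC [y in LHS]cbasis_expand (linear_expand _ _ (sL _)) scaler_sumr.
by apply: eq_bigr => l _; rewrite scalerA sprodC.
Qed.

Lemma monom2_span (u : U) : exists c : 'I_n * 'I_n -> K, u = \sum_q c q *: monom2 q.
Proof.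
exists (fun q => \sum_p u p *
  ((basis_vec (val p).1 : V) q.1 0 * (basis_vec (val p).2 : V) q.2 0)).
rewrite [LHS]sym2_expand.
under eq_bigr => p _ do rewrite sprod_expand scaler_sumr.
rewrite exchange_big /=; apply: eq_bigr => q _; rewrite scaler_suml.
by apply: eq_bigr => p _; rewrite scalerA.
Qed.

Lemma act1 d w : act d 1%:M w = w.
Proof. by apply: ext_map_id => u; apply: sym2_map_id => v; rewrite gl_actE mul1mx. Qed.

Lemma actM d g h w : act d (g *m h) w = act d g (act d h w).
Proof.
by apply: ext_map_comp => u; apply: sym2_map_comp => v; rewrite !gl_actE mulmxA.
Qed.

Lemma sym2_map_monom2 (g : 'M[K]_n) q :
  sym2_map (gl_act g) (monom2 q) = \sum_r (g r.1 q.1 * g r.2 q.2) *: monom2 r.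
Proof.
rewrite sym2_map_sprod !gl_actE sprod_expand; apply: eq_bigr => r _.
by rewrite -!colE !mxE.
Qed.

(** The index (a, b) is the first or second letter of the a-th quadratic factor. *)
Definition wedge_word d (w : {ffun 'I_d * bool -> 'I_n}) : ext_sym2 K n d :=
  wedge [ffun a => monom2 (w (a, false), w (a, true))].

Lemma act_wedge_word d g (w : {ffun 'I_d * bool -> 'I_n}) :
  act d g (wedge_word w)
  = \sum_(v : {ffun 'I_d * bool -> 'I_n}) (\prod_x g (v x) (w x)) *: wedge_word v.
Proof.
rewrite /ext_sym2_act ext_map_wedge.
rewrite (_ : [ffun a => _] = [ffun a => \sum_q
    (g q.1 (w (a, false)) * g q.2 (w (a, true))) *: monom2 q]); last first.
  by apply/ffunP => a; rewrite !ffunE sym2_map_monom2.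
rewrite wedge_expand.
rewrite (reindex (fun v : {ffun 'I_d * bool -> 'I_n} =>
   [ffun a => (v (a, false), v (a, true))])) /=; last first.
  exists (fun f : {ffun 'I_d -> 'I_n * 'I_n} =>
     [ffun x => if x.2 then (f x.1).2 else (f x.1).1]) => [v|f] _.
    by apply/ffunP => [[a []]]; rewrite !ffunE.
  by apply/ffunP => a; rewrite !ffunE /=; case: (f a).
apply: eq_bigr => v _; congr (_ *: _); last first.
  by rewrite /wedge_word; congr wedge; apply/ffunP => a; rewrite !ffunE.
transitivity (\prod_(a < d) \prod_(b : bool) g (v (a, b)) (w (a, b))).
  by apply: eq_bigr => a _; rewrite big_bool ffunE /= mulrC.
by rewrite pair_bigA; apply: eq_bigr => [[a b]].
Qed.

Lemma wedge_word_span d (h : {linear ext_sym2 K n d -> K^o}) :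
  (forall w, h (wedge_word w) = 0) -> forall v, h v = 0.
Proof.
move=> h0 v; rewrite [v]ext_expand linear_sum big1 // => s _; rewrite linearZ /=.
have /fin_all_exists[c cE] (a : 'I_d) := monom2_span (basis_vec (val s a)).
rewrite (_ : [ffun a => _] = [ffun a => \sum_q c a q *: monom2 q]); last first.
  by apply/ffunP => a; rewrite !ffunE -cE.
rewrite wedge_expand linear_sum big1 ?scaler0 // => f _.
rewrite linearZ /= (_ : wedge _ =
   wedge_word [ffun x => if x.2 then (f x.1).2 else (f x.1).1]) ?h0 ?scaler0 //.
by congr wedge; apply/ffunP => a; rewrite !ffunE /=; case: (f a).
Qed.

Variables (A : algType K) (xi : {linear U -> A}).
Hypothesis xi_sq : forall u, xi u * xi u = 0.
Hypothesis xi_inj : forall d (w : ext_pow d U), ext_eval xi w = 0 -> w = 0.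

Definition generic_mx : 'M[A]_n := \matrix_(i, j) xi (monom2 (i, j)).

Lemma generic_mx_anti i j k l :
  generic_mx i j * generic_mx k l = - (generic_mx k l * generic_mx i j).
Proof. by rewrite !mxE xi_anti. Qed.

Lemma generic_mx_sym i j : generic_mx i j = generic_mx j i.
Proof. by rewrite !mxE /monom2 sprodC. Qed.

(** The matrix of generators after acting by g. *)
Definition congmx (g : 'M[K]_n) : 'M[A]_n :=
  map_mx (in_alg A) g^T *m generic_mx *m map_mx (in_alg A) g.

(** phi, a noncommutative polynomial in the entries of a matrix, comes from a single
    element w of the exterior power, and acting by g on w amounts to substituting
    g^T X g for X.  So w is invariant as soon as phi is a function of traces of
    powers. *)
Definition realized d (phi : 'M[A]_n -> A) := exists w : ext_sym2 K n d,
  forall g, ext_eval xi (act d g w) = phi (congmx g).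

Lemma congmxE g i j : congmx g i j = xi (sym2_map (gl_act g) (monom2 (i, j))).
Proof.
rewrite sym2_map_monom2 -(pair_bigA _ (fun k l => (g k i * g l j) *: monom2 (k, l))).
rewrite /congmx mxE exchange_big linear_sum; apply: eq_bigr => l _ /=.
rewrite linear_sum mxE mulr_suml; apply: eq_bigr => k _.
by rewrite linearZ /= !mxE -!scalerAl mul1r -scalerAr mulr1 scalerA.
Qed.

Lemma realized_entry i j : realized 1 (fun Z => Z i j).
Proof.
exists (wedge [ffun=> monom2 (i, j)]) => g.
by rewrite /ext_sym2_act ext_map_wedge ext_eval_wedge // big_ord1 !ffunE congmxE.
Qed.

Lemma realized_const c : realized 0 (fun _ => c%:A).
Proof.
exists (c *: wedge [ffun=> 0]) => g.
by rewrite !linearZ /= /ext_sym2_act ext_map_wedge ext_eval_wedge // big_ord0.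
Qed.

Lemma realized_sum (I : finType) d (phi : I -> 'M[A]_n -> A) :
  (forall i, realized d (phi i)) -> realized d (fun Z => \sum_i phi i Z).
Proof.
move=> /fin_all_exists[w wE]; exists (\sum_i w i) => g.
by rewrite !linear_sum; apply: eq_bigr => i _; apply: wE.
Qed.

(** The exterior product of two elements, written on the wedges of basis vectors. *)
Lemma realized_mul d1 d2 phi1 phi2 : realized d1 phi1 -> realized d2 phi2 ->
  realized (d1 + d2) (fun Z => phi1 Z * phi2 Z).
Proof.
move=> [w1 w1E] [w2 w2E].
pose cat (s1 : ext_index d1 _) (s2 : ext_index d2 _) : {ffun 'I_(d1 + d2) -> U} :=
  [ffun a => match split a with
             | inl b => basis_vec (val s1 b) | inr b => basis_vec (val s2 b) end].
exists (\sum_s1 \sum_s2 (w1 s1 * w2 s2) *: wedge (cat s1 s2)) => g.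
rewrite -w1E -w2E ![act _ g _ in RHS]ext_mapE !linear_sum mulr_suml.
apply: eq_bigr => s1 _; rewrite !linear_sum mulr_sumr; apply: eq_bigr => s2 _.
rewrite !linearZ /= /ext_sym2_act ext_map_wedge !ext_eval_wedge // big_split_ord /=.
rewrite -scalerAl -scalerAr scalerA; congr (_ *: (_ * _)); apply: eq_bigr => a _;
  rewrite !ffunE; [rewrite (unsplitK (inl a))|rewrite (unsplitK (inr a))] => //.
Qed.

Lemma realized_pow k i j : realized k (fun Z => (Z ^+ k) i j).
Proof.
elim: k i j => [|k IH] i j.
  have [w wE] := realized_const ((i == j)%:R); exists w => g.
  by rewrite wE expr0 mxE scaler_nat.
have [|w wE] := @realized_sum 'I_n k.+1 (fun l Z => Z i l * (Z ^+ k) l j).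
  by move=> l; apply: (@realized_mul 1 k _ _ (realized_entry i l) (IH l j)).
by exists w => g; rewrite wE mxXS.
Qed.

Lemma realized_trace_monomial (S : {set 'I_(uphalf n)}) :
  realized (\sum_(j in S) (4 * j).+1)%N (fun Z => trace_monomial Z S).
Proof.
rewrite -big_enum /trace_monomial; elim: (enum S) => [|j s IH].
  rewrite big_nil; have [w wE] := realized_const 1; exists w => g.
  by rewrite wE big_nil scale1r.
rewrite big_cons.
have trR : realized (4 * j).+1 (fun Z => \tr (Z ^+ (4 * j).+1)).
  by apply: realized_sum => i; apply: realized_pow.
have [w wE] := realized_mul trR IH; exists w => g.
by rewrite wE big_cons.
Qed.

Lemma congmx1 : congmx 1%:M = generic_mx.
Proof. by rewrite /congmx trmx1 map_mx1 mul1mx mulmx1. Qed.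

Lemma trace_congmx (g : 'M[K]_n) k : g^T *m g = 1%:M ->
  \tr (congmx g ^+ k) = \tr (generic_mx ^+ k).
Proof.
move=> gO; have gO' : g *m g^T = 1%:M by apply: mulmx1C.
pose G := map_mx (in_alg A) g; pose G' := map_mx (in_alg A) g^T.
have GG' : G *m G' = 1%:M by rewrite -map_mxM gO' map_mx1.
have G'G : G' *m G = 1%:M by rewrite -map_mxM gO map_mx1.
have -> : congmx g ^+ k = G' *m (generic_mx ^+ k) *m G.
  elim: k => [|k IH]; first by rewrite !expr0 mulmx1.
  rewrite exprS IH exprS -[LHS]/(_ *m _) -[generic_mx * _]/(_ *m _) /congmx.
  by rewrite -!mulmxA [G *m (G' *m _)]mulmxA GG' mul1mx.
move: (generic_mx ^+ k) => Y; rewrite -[in RHS](mul1mx Y) -GG' -[in RHS]mulmxA.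
have GC i j (z : A) : G i j * z = z * G i j by rewrite !mxE mulr_algl mulr_algr.
rewrite /mxtrace (eq_bigr (fun i => \sum_j (G' *m Y) i j * G j i)); last first.
  by move=> i _; rewrite mxE.
by rewrite exchange_big; apply: eq_bigr => j _; rewrite mxE;
  apply: eq_bigr => i _; rewrite GC.
Qed.

Lemma exists_trace_monomial d (S : {set 'I_(uphalf n)}) :
  (\sum_(j in S) (4 * j).+1)%N = d -> exists w : ext_sym2 K n d,
  [/\ ext_eval xi w = trace_monomial generic_mx S,
      forall g, ext_eval xi (act d g w) = trace_monomial (congmx g) S
    & forall g, orthogonal_group K n g -> act d g w = w].
Proof.
move=> <-; have [w wE] := realized_trace_monomial S.
have w1 : ext_eval xi w = trace_monomial generic_mx S by rewrite -(act1 w) wE congmx1.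
exists w; split=> // g gO; apply/eqP; rewrite -subr_eq0; apply/eqP/xi_inj.
rewrite linearB /= wE w1 /trace_monomial.
by apply/eqP; rewrite subr_eq0; apply/eqP/eq_bigr => j _; rewrite trace_congmx.
Qed.

(** Full contractions of the tensor of all wedges are trace monomials: in the
    matrix algebra, the wedges become products of entries of X. *)
Lemma contrs_wedge_word d s w :
  perm_eq (ends s) (enum {: 'I_d * bool}) ->
  ext_eval xi (contrs s (@wedge_word d) w) = 0 \/
  exists (eps : bool) (S : {set 'I_(uphalf n)}),
    ext_eval xi (contrs s (@wedge_word d) w) = (-1) ^+ eps * trace_monomial generic_mx S
    /\ (\sum_(j in S) (4 * j).+1)%N = d.
Proof.
move=> sperm; pose L := [seq (1%N, (a, false), (a, true)) | a <- enum 'I_d].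
have Lperm : perm_eq (labels L) (ends s).
  rewrite perm_sym (perm_trans sperm) //.
  have -> : labels L = [seq (a, b) | a <- enum 'I_d, b <- [:: false; true]].
    by rewrite /labels -map_comp.
  apply: uniq_perm; first exact: enum_uniq.
    by apply: allpairs_uniq; rewrite ?enum_uniq // => [[a b] [a' b']] _ _ /= [-> ->].
  move=> [a b]; rewrite mem_enum; apply/esym/allpairsP; exists (a, b).
  by rewrite mem_enum; case: b.
have Lu : uniq (labels L) by rewrite (perm_uniq Lperm) (perm_uniq sperm) enum_uniq.
have Lpos : all (fun p => 0 < p.1.1)%N L by apply/allP => _ /mapP[a _ ->].
have Ldeg : degree L = d.
  by rewrite /degree -map_comp sumnE big_map big_enum sum1_card card_ord.
have chainE v : ext_eval xi (wedge_word v) = chain generic_mx L v.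
  rewrite ext_eval_wedge // /chain big_map prod_enum; apply: eq_bigr => a _.
  by rewrite ffunE mxE.
rewrite -contrs_morph => [|F]; last by rewrite linear_sum.
rewrite (contrs_eq s chainE).
have [eps [ks [-> kspos degE]]] := contrs_chain generic_mx_anti generic_mx_sym Lu Lperm Lpos.
have [->|[eps' [S [-> SE]]]] := ptrace_prod generic_mx_anti generic_mx_sym kspos.
  by left; rewrite mulr0.
right; exists (eps (+) eps'), S; rewrite signr_addb -mulrA; split=> //.
by rewrite SE -degE Ldeg.
Qed.

(** An invariant functional h defines the invariant tensor of its values on the
    wedges; the full contractions of that tensor are the values of h on trace
    monomials. *)
Theorem invariant_functional_eq0 d (h : {linear ext_sym2 K n d -> K^o}) :
  (forall i j t w, i != j -> 1 + t ^+ 2 != 0 ->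
     h (act d (plane_rotation i j t) w) = h w) ->
  (forall i w, h (act d (coord_reflection K i) w) = h w) ->
  (forall w S, ext_eval xi w = trace_monomial generic_mx S ->
     (\sum_(j in S) (4 * j).+1)%N = d -> h w = 0) ->
  forall w, h w = 0.
Proof.
move=> hrot href hS; apply: wedge_word_span.
have fixesE g : (forall w, h (act d g w) = h w) ->
    fixes (h \o @wedge_word d) g.
  move=> hg w; rewrite /= -hg act_wedge_word linear_sum; apply: eq_bigr => v _.
  by rewrite linearZ.
apply: (@invariant_matchings_eq0 _ n K (h \o @wedge_word d)).
- by move=> i j t ij t0; apply: fixesE => w; apply: hrot.
- by move=> i; apply: fixesE.
move=> s sperm w; rewrite contrs_morph => [|F]; last by rewrite linear_sum.
set v := contrs _ _ _.
have [/xi_inj v0|[eps [S [vE Sd]]]] := contrs_wedge_word w sperm.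
  by rewrite /v v0 linear0.
have : h ((-1) ^+ eps *: v) = 0.
  apply: (hS _ S) => //; rewrite linearZ /= vE.
  by rewrite scaler_sign mulr_sign; case: eps {vE}; rewrite ?opprK.
by rewrite linearZ /= => /eqP; rewrite scaler_eq0 signr_eq0 => /eqP.
Qed.

End Link.

(** * Rotations and the top exterior power of the symmetric square *)

Ltac rewrite_neqs :=
  repeat match goal with
  | H : is_true (?x != ?y) |- _ =>
    rewrite ?(negPf H); rewrite eq_sym in H; rewrite ?(negPf H); clear H
  end.

Lemma coord_reflection_sq (K : numFieldType) n (i : 'I_n) :
  coord_reflection K i *m coord_reflection K i = 1%:M.
Proof.
apply/matrixP => k l; rewrite !mxE (bigD1 k) //= !mxE eqxx big1 ?addr0 => [|m mk].
  by case: (k == l); rewrite ?mulr0 // -signr_addb addbb.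
by rewrite !mxE eq_sym (negPf mk) mul0r.
Qed.

Lemma coord_reflection_tr (K : numFieldType) n (i : 'I_n) :
  (coord_reflection K i)^T = coord_reflection K i.
Proof. by apply/matrixP => k l; rewrite !mxE eq_sym; have [->|] := eqVneq k l. Qed.

Section PlaneMatrices.
Variables (K : numFieldType) (n : nat) (i j : 'I_n).
Hypothesis ij : i != j.

(** The 2 x 2 matrix with rows (a, b) and (c, d) in the plane of e_i and e_j. *)
Definition plane_mx (a b c d : K) : 'M[K]_n :=
  \matrix_(k, l)
    if k == i then (if l == i then a else if l == j then b else 0)
    else if k == j then (if l == i then c else if l == j then d else 0)
    else (k == l)%:R.

Lemma plane_mxM a b c d a' b' c' d' :
  plane_mx a b c d *m plane_mx a' b' c' d'
  = plane_mx (a * a' + b * c') (a * b' + b * d') (c * a' + d * c') (c * b' + d * d').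
Proof.
have ji : j != i by rewrite eq_sym.
have row_k (M M' : 'M[K]_n) k l : (forall m, m != i -> m != j -> M k m = 0) ->
    (M *m M') k l = M k i * M' i l + M k j * M' j l.
  move=> M0; rewrite mxE (bigD1 i) //= (bigD1 j) ?ji //= big1 ?addr0 // => m.
  by case/andP => mi mj; rewrite M0 ?mul0r.
apply/matrixP => k l; have [-> {k}|ki] := eqVneq k i.
  rewrite row_k => [|m mi mj]; last by rewrite !mxE eqxx (negPf mi) (negPf mj).
  rewrite !mxE !eqxx (negPf ji).
  by case: (l == i); [|case: (l == j)]; rewrite ?mulr0 ?addr0.
have [-> {k ki}|kj] := eqVneq k j.
  rewrite row_k => [|m mi mj]; last by rewrite !mxE eqxx (negPf ji) (negPf mi) (negPf mj).
  rewrite !mxE !eqxx (negPf ji).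
  by case: (l == i); [|case: (l == j)]; rewrite ?mulr0 ?addr0.
rewrite mxE (bigD1 k) //= !mxE (negPf ki) (negPf kj) eqxx mul1r.
rewrite big1 ?addr0 // => m mk.
by rewrite !mxE (negPf ki) (negPf kj) eq_sym (negPf mk) mul0r.
Qed.

Ltac plane_cases :=
  have ? := ij; let k := fresh in let l := fresh in
  apply/matrixP => k l; rewrite !mxE;
  have [?|?] := eqVneq k i; [subst k|have [?|?] := eqVneq k j; [subst k|]];
  (have [?|?] := eqVneq l i; [subst l|have [?|?] := eqVneq l j; [subst l|]]);
  rewrite ?eqxx; rewrite_neqs; rewrite ?mulr1n ?mulr0n ?andbF.

Lemma plane_mx1 : plane_mx 1 0 0 1 = 1%:M.
Proof. plane_cases => //. Qed.

Lemma plane_mx_tr a b c d : (plane_mx a b c d)^T = plane_mx a c b d.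
Proof. plane_cases => //; by rewrite eq_sym. Qed.

Lemma plane_rotationE t : plane_rotation i j t
  = plane_mx ((1 - t ^+ 2) / (1 + t ^+ 2)) (t *+ 2 / (1 + t ^+ 2))
      (- (t *+ 2) / (1 + t ^+ 2)) ((1 - t ^+ 2) / (1 + t ^+ 2)).
Proof. plane_cases => //; by case: (_ == _). Qed.

Lemma coord_reflectionEr : coord_reflection K j = plane_mx 1 0 0 (-1).
Proof. plane_cases; rewrite ?expr0 ?expr1 //; by case: (_ == _). Qed.

Lemma coord_reflectionEl : coord_reflection K i = plane_mx (-1) 0 0 1.
Proof. plane_cases; rewrite ?expr0 ?expr1 //; by case: (_ == _). Qed.
End PlaneMatrices.

Section SymDimension.
Variable K : fieldType.

Lemma card_sym_index m : #|{: sym_index m}| = (\sum_(j < m) j.+1)%N.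
Proof.
rewrite card_sig; transitivity (\sum_(j < m) \sum_(i < m | i <= j) 1)%N.
  rewrite (exchange_big_dep predT) //= pair_big_dep /= sum1_card.
  by apply: eq_card => p; rewrite !inE.
apply: eq_bigr => j _.
rewrite (eq_bigl (fun i : 'I_m => i < j.+1)%N) // -(big_ord_widen m (fun=> 1%N)) //.
by rewrite sum1_card card_ord.
Qed.

Lemma dim_ffun (I : finType) : \dim {: {ffun I -> K^o}} = #|I|.
Proof. by rewrite dimvf; apply: muln1. Qed.

Lemma dim_cV n : \dim {: 'cV[K]_n} = n.
Proof. by rewrite dimvf dim_matrix -[RHS]muln1. Qed.

Lemma dim_sym2 n : \dim {: sym2 'cV[K]_n} = (\sum_(j < n) j.+1)%N.
Proof. by rewrite dim_ffun card_sym_index dim_cV. Qed.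

Lemma sum_4j1 n : odd n ->
  (\sum_(j < uphalf n) (4 * j).+1)%N = (\sum_(j < n) j.+1)%N.
Proof.
move=> n_odd; have -> : n = (n./2.*2).+1 by rewrite -[LHS]odd_double_half n_odd.
move: n./2 => m.
have -> : uphalf m.*2.+1 = m.+1 by lia.
elim: m => [|m IH]; first by rewrite !big_ord1.
have recr k : (\sum_(j < k.+1) j.+1 = \sum_(j < k) j.+1 + k.+1)%N.
  by rewrite big_ord_recr.
rewrite big_ord_recr IH doubleS (recr m.*2.+2) (recr m.*2.+1) -addnA.
by congr (_ + _)%N; rewrite /=; lia.
Qed.
End SymDimension.

Lemma sprodNN (K : fieldType) (U : vectType K) (u v : U) :
  sprod (- u) (- v) = sprod u v.
Proof.
have cdN a x : cd a (- x) = - cd a x :> K by apply: linearN.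
by apply/ffunP => q; rewrite !ffunE /= !cdN !mulrNN.
Qed.

Section TopForm.
Variables (K : numFieldType) (n : nat).
Local Notation V := ('cV[K]_n : vectType K).
Local Notation U := (sym2 V).
Local Notation N := (\dim {: U}).
Local Notation act g := (ext_sym2_act K n N g).

Definition top_index : ext_index N N.
Proof.
by exists [ffun a => a]; apply/forallP => a; apply/forallP => b; rewrite !ffunE implybb.
Defined.

Lemma top_index_unique (s : ext_index N N) : s = top_index.
Proof.
apply/val_inj/increasing_eq; try exact: valP.
by move=> a; exists (val s a); rewrite ffunE.
Qed.

Definition top_coord (w : ext_sym2 K n N) : K^o := w top_index.

Lemma top_coord_is_linear : linear top_coord.
Proof. by move=> c u v; rewrite /top_coord !ffunE. Qed.

HB.instance Definition _ :=
  GRing.isLinear.Build K (ext_sym2 K n N) K^o _ top_coord top_coord_is_linear.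

Definition top_form : ext_sym2 K n N := [ffun=> 1].

Lemma top_formE w : w = top_coord w *: top_form.
Proof.
apply/ffunP => s; rewrite (top_index_unique s) !ffunE /GRing.scale /=.
by rewrite mulr1.
Qed.

(** The top exterior power is a line, and g acts on it by this scalar; it is a
    multiplicative character of all matrices. *)
Definition top_char (g : 'M[K]_n) : K := top_coord (act g top_form).

Lemma act_top g w : top_coord (act g w) = top_char g * top_coord w.
Proof. by rewrite [w in LHS]top_formE !linearZ /= mulrC. Qed.

Lemma top_char1 : top_char 1%:M = 1.
Proof. by rewrite /top_char act1 /top_coord ffunE. Qed.

Lemma top_charM g h : top_char (g *m h) = top_char g * top_char h.
Proof. by rewrite {1}/top_char actM act_top. Qed.

Lemma top_char_opp1 : top_char (- 1%:M) = 1.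
Proof.
rewrite /top_char (_ : act _ _ = top_form) ?/top_coord ?ffunE //.
apply: ext_map_id => u; rewrite [RHS]sym2_expand sym2_mapE; apply: eq_bigr => p _.
by rewrite !gl_actE !mulNmx !mul1mx sprodNN.
Qed.

Lemma top_char_reflection_sq i : top_char (coord_reflection K i) ^+ 2 = 1.
Proof. by rewrite expr2 -top_charM coord_reflection_sq top_char1. Qed.

(** A rotation is the commutator of a reflection r and the similarity h with matrix
    (1, t; -t, 1), so every multiplicative character is 1 on it. *)
Lemma top_char_rotation i j t : i != j -> 1 + t ^+ 2 != 0 ->
  top_char (plane_rotation i j t) = 1.
Proof.
move=> ij t0; pose s := 1 + t ^+ 2.
pose h := plane_mx i j 1 t (- t) 1.
pose h' := plane_mx i j s^-1 (- t / s) (t / s) s^-1.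
pose r := coord_reflection K j.
have hh' : h *m h' = 1%:M.
  by rewrite -(plane_mx1 K ij) plane_mxM //; congr plane_mx; rewrite /s; field.
have -> : plane_rotation i j t = h *m r *m h' *m r.
  rewrite plane_rotationE // /r (@coord_reflectionEr K n i j ij) !plane_mxM //.
  by congr plane_mx; rewrite /s; field.
have := top_char_reflection_sq j; rewrite -/r !top_charM.
have : top_char h * top_char h' = 1 by rewrite -top_charM hh' top_char1.
move: (top_char h) (top_char h') (top_char r) => x y z xy z2.
by rewrite [x * z]mulrC -[z * x * y]mulrA xy mulr1 -expr2.
Qed.

(** The product of two reflections is the square of a quarter turn, so all n
    reflections have the same value, 1 or -1.  Their product -1 acts trivially on
    S^2 V, and n is odd. *)
Lemma top_char_reflection i : odd n -> top_char (coord_reflection K i) = 1.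
Proof.
move=> n_odd.
have eqc j : top_char (coord_reflection K j) = top_char (coord_reflection K i).
  have [->//|ji] := eqVneq j i.
  have J0 : 1 + 1 ^+ 2 != 0 :> K by rewrite expr1n -[1 + 1]/(2%:R) pnatr_eq0.
  (* At t = 1 the rotation is a quarter turn. *)
  have E : coord_reflection K j *m coord_reflection K i
      = plane_rotation j i 1 *m plane_rotation j i 1.
    rewrite (@coord_reflectionEl K n j i ji) (@coord_reflectionEr K n j i ji).
    rewrite plane_rotationE // !plane_mxM //.
    by congr plane_mx; field.
  have := top_char_reflection_sq i.
  have : top_char (coord_reflection K j) * top_char (coord_reflection K i) = 1.
    by rewrite -top_charM E top_charM top_char_rotation // mulr1.
  move: (top_char (coord_reflection K j)) (top_char (coord_reflection K i)) => x y xy y2.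
  by rewrite -[x]mulr1 -y2 expr2 mulrA xy mul1r.
(* The product of the first k reflections. *)
pose D k : 'M[K]_n := diag_mx (\row_l (-1) ^+ (l < k)%N).
have DE k : (k <= n)%N -> top_char (D k) = top_char (coord_reflection K i) ^+ k.
  elim: k => [|k IH] kn.
    rewrite expr0 -top_char1; congr top_char; apply/matrixP => a b.
    by rewrite !mxE.
  rewrite exprSr -IH ?(ltnW kn) // -(eqc (Ordinal kn)) -top_charM; congr top_char.
  apply/matrixP => a b; rewrite mul_diag_mx !mxE.
  have [_|] := eqVneq a b; last by rewrite mulr0.
  rewrite mulr1n -signr_addb -val_eqE /= ltnS leq_eqVlt.
  by case: (ltngtP a k).
have : top_char (D n) = 1.
  rewrite -[RHS]top_char_opp1; congr top_char; apply/matrixP => a b.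
  by rewrite !mxE ltn_ord mulNrn.
have nE := odd_double_half n; rewrite n_odd in nE.
rewrite DE // -[X in _ ^+ X]nE exprD -muln2 mulnC exprM.
by rewrite top_char_reflection_sq expr1n mulr1.
Qed.

End TopForm.

(** * Independence of the trace monomials *)

Lemma sum_pos_subset (T : finType) (f : T -> nat) (S S' : {set T}) :
  (forall j, 0 < f j)%N -> S \subset S' ->
  (\sum_(j in S) f j)%N = (\sum_(j in S') f j)%N -> S = S'.
Proof.
move=> f0 SS' E; apply/eqP; rewrite eqEsubset SS' -setD_eq0 /=.
apply: contraT => /set0Pn[j jD]; move: E.
rewrite [RHS](big_setID S) /= (setIidPr SS') -[LHS]addn0 => /addnI/esym/eqP.
rewrite sum_nat_eq0 => /forallP/(_ j); rewrite jD /= => /eqP f_j0.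
by have := f0 j; rewrite f_j0.
Qed.

Section FullMonomial.
Variables (K : numFieldType) (A : algType K).

Lemma trace_monomialT n (Z : 'M[A]_n) :
  trace_monomial Z setT = \prod_(j < uphalf n) \tr (Z ^+ (4 * j).+1).
Proof. by rewrite /trace_monomial enum_setT -enumT prod_enum. Qed.

(** The coordinate on the top exterior power is a nonzero invariant functional, so it
    is nonzero on some trace monomial; all of them have smaller degree except the
    full one. *)
Lemma full_monomial_odd_neq0 n (xi : {linear sym2 'cV[K]_n -> A}) :
  (forall u, xi u * xi u = 0) ->
  (forall d (w : ext_pow d (sym2 'cV[K]_n)), ext_eval xi w = 0 -> w = 0) ->
  odd n -> trace_monomial (generic_mx xi) setT != 0.
Proof.
move=> xi_sq xi_inj n_odd; apply/eqP => E.
suff H : forall w, @top_coord K n w = 0.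
  by have := H (@top_form K n); rewrite /top_coord ffunE => /eqP; rewrite oner_eq0.
apply: (invariant_functional_eq0 xi_sq xi_inj (h := @top_coord K n)).
- by move=> i j t w ij t0; rewrite /= act_top top_char_rotation // mul1r.
- by move=> i w; rewrite /= act_top top_char_reflection // mul1r.
move=> w S wE Sd.
have ST : S = setT.
  apply: (sum_pos_subset (f := fun j : 'I_(uphalf n) => (4 * j).+1)) => //.
  rewrite Sd dim_sym2 -sum_4j1 //; apply: eq_bigl => j.
  by rewrite inE.
by rewrite (xi_inj _ w) ?linear0 // wE ST E.
Qed.

Lemma drop_first_pow n (Z : 'M[A]_n.+1) (Z' : 'M[A]_n) :
  (forall i, Z ord0 i = 0) -> (forall i, Z i ord0 = 0) ->
  (forall i j, Z (lift ord0 i) (lift ord0 j) = Z' i j) ->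
  forall k, \tr (Z ^+ k.+1) = \tr (Z' ^+ k.+1).
Proof.
move=> Z0 Z0' ZZ' k.
have powE m i j : (Z ^+ m) (lift ord0 i) (lift ord0 j) = (Z' ^+ m) i j.
  elim: m i j => [|m IH] i j; first by rewrite !expr0 !mxE (inj_eq lift_inj).
  rewrite !mxXS big_ord_recl Z0' mul0r add0r.
  by apply: eq_bigr => l _; rewrite ZZ' IH.
rewrite /mxtrace big_ord_recl mxXS big1 ?add0r => [|l _]; last by rewrite Z0 mul0r.
by apply: eq_bigr => i _; rewrite powE.
Qed.

(** For even n, apply the projection g that kills the first basis vector.  If the
    full monomial were 0 it would stay 0 after acting by g, but it then becomes the
    full monomial of a generic matrix of odd size n - 1: the number n/2 of its
    factors is the same for both sizes. *)
Lemma full_monomial_neq0 n (xi : {linear sym2 'cV[K]_n -> A}) :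
  (0 < n)%N -> (forall u, xi u * xi u = 0) ->
  (forall d (w : ext_pow d (sym2 'cV[K]_n)), ext_eval xi w = 0 -> w = 0) ->
  trace_monomial (generic_mx xi) setT != 0.
Proof.
case: n xi => // n xi _ xi_sq xi_inj.
have [n_odd|n_even] := boolP (odd n.+1); first exact: full_monomial_odd_neq0.
pose B : 'M[K]_(n.+1, n) := \matrix_(k, l) (k == lift ord0 l)%:R.
have BB : B^T *m B = 1%:M.
  apply/matrixP => k l; rewrite !mxE (bigD1 (lift ord0 k)) //= !mxE eqxx mul1r.
  rewrite big1 ?addr0 ?(inj_eq lift_inj) // => m mk.
  by rewrite !mxE (negPf mk) mul0r.
pose incl : 'Hom('cV[K]_n, 'cV[K]_n.+1) := linfun (mulmx B).
pose retr : 'Hom('cV[K]_n.+1, 'cV[K]_n) := linfun (mulmx B^T).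
have retr_incl u : retr (incl u) = u by rewrite !lfunE /= mulmxA BB mul1mx.
pose xi' : {linear sym2 'cV[K]_n -> A} := xi \o sym2_map incl.
have xi'_sq u : xi' u * xi' u = 0 by apply: xi_sq.
have xi'_inj d (w : ext_pow d (sym2 'cV[K]_n)) : ext_eval xi' w = 0 -> w = 0.
  move=> w0; have : ext_map d (sym2_map incl) w = 0.
    apply: xi_inj; rewrite -[RHS]w0 ext_mapE linear_sum ext_evalE.
    apply: eq_bigr => s _; rewrite linearZ /= ext_eval_wedge //; congr (_ *: _).
    by apply: eq_bigr => a _; rewrite ffunE.
  move/(congr1 (ext_map d (sym2_map retr))); rewrite linear0.
  rewrite -(@ext_map_comp _ d _ _ _ (sym2_map incl) (sym2_map retr) \1%VF).
    by rewrite ext_map_id // => u; rewrite lfunE.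
  move=> u; rewrite lfunE /=.
  rewrite -(@sym2_map_comp _ _ _ _ incl retr \1%VF).
    by rewrite sym2_map_id // => v; rewrite lfunE.
  by move=> v; rewrite lfunE /= retr_incl.
have := full_monomial_odd_neq0 xi'_sq xi'_inj; rewrite -[odd n]negbK => /(_ n_even).
apply: contraNneq => E.
have [w [wE wgE _]] := exists_trace_monomial xi_sq xi_inj (erefl
   (\sum_(j in [set: 'I_(uphalf n.+1)]) (4 * j).+1)%N).
have w0 : w = 0 by apply: xi_inj; rewrite wE E.
pose g : 'M[K]_n.+1 := \matrix_(k, l) ((k == l) && (k != ord0))%:R.
have := wgE g; rewrite w0 !linear0 trace_monomialT => gE.
apply/eqP; rewrite trace_monomialT [RHS]gE.
have -> : uphalf n = uphalf n.+1 by move: n_even; lia.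
have gE' i j : congmx xi g i j =
    if (i == ord0) || (j == ord0) then 0 else generic_mx xi i j.
  rewrite congmxE // sym2_map_monom2 (bigD1 (i, j)) //= big1 ?addr0.
    rewrite !mxE !eqxx /=; case: eqP => _; first by rewrite mul0r scale0r linear0.
    by case: eqP => _; rewrite ?mulr0 ?scale0r ?linear0 // mul1r scale1r.
  move=> [k l] /=; rewrite xpair_eqE negb_and => /orP[ki|lj]; rewrite !mxE.
    by rewrite (negPf ki) mul0r scale0r.
  by rewrite (negPf lj) mulr0 scale0r.
apply: eq_bigr => j _; apply/esym/drop_first_pow => [i|i|i k].
- by rewrite gE' eqxx.
- by rewrite gE' eqxx orbT.
rewrite gE' -!val_eqE /= !mxE /= sym2_map_sprod; congr (xi (sprod _ _)).
  rewrite lfunE /=; apply/colP => l; rewrite -[RHS]/((B *m cbasis K i) l 0).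
  by rewrite -colE !mxE andbT.
rewrite lfunE /=; apply/colP => l; rewrite -[RHS]/((B *m cbasis K k) l 0).
by rewrite -colE !mxE andbT.
Qed.

(** Multiplying by the monomial of the complement of S0 keeps only S0: another
    subset of the same degree is not contained in S0, so a factor is repeated. *)
Lemma trace_monomials_free n (X : 'M[A]_n) d (c : {set 'I_(uphalf n)} -> K) :
  (forall i j k l, X i j * X k l = - (X k l * X i j)) ->
  trace_monomial X setT != 0 ->
  \sum_(S : {set 'I_(uphalf n)} | (\sum_(j in S) (4 * j).+1)%N == d)
     c S *: trace_monomial X S = 0 ->
  forall S : {set 'I_(uphalf n)}, (\sum_(j in S) (4 * j).+1)%N = d -> c S = 0.
Proof.
move=> XC full E S0 S0d.
pose f (j : 'I_(uphalf n)) := ptrace X (4 * j).+1.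
have fE (i j : 'I_(uphalf n)) : f i * f j = (-1) ^+ true * (f j * f i).
  by rewrite /f (ptrace_comm XC) oddM /= !oddM.
have ff j : f j * f j = 0 by apply: eq_opp_eq0; rewrite [LHS]fE expr1 mulN1r.
have mulE S S' : trace_monomial X S * trace_monomial X S'
    = \prod_(j <- enum S ++ enum S') f j by rewrite big_cat.
have := congr1 ( *%R^~ (trace_monomial X (~: S0))) E.
rewrite mul0r mulr_suml (bigD1 S0) ?S0d //= big1 ?addr0 => [|S /andP[/eqP Sd SS0]].
  have /(prod_perm_sign (fun _ _ => true))[eps epsE] :
      perm_eq (enum S0 ++ enum (~: S0)) (enum [set: 'I_(uphalf n)]).
    apply: uniq_perm; rewrite ?enum_uniq ?cat_uniq ?enum_uniq ?andbT //=.
      by apply/hasPn => j; rewrite !mem_enum inE.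
    by move=> j; rewrite mem_cat !mem_enum !inE orbN.
  rewrite -scalerAl mulE (epsE A f fE) -/(trace_monomial X setT) mulr_sign => /eqP.
  rewrite scaler_eq0 => /orP[/eqP //|].
  by case: ifP; rewrite ?oppr_eq0 (negPf full).
rewrite -scalerAl mulE (prod_dup_eq0 (e := fun _ _ => true)) ?scaler0 //.
apply: contra SS0; rewrite cat_uniq !enum_uniq andbT /= => /hasPn H.
apply/eqP; apply: (sum_pos_subset (f := fun j : 'I_(uphalf n) => (4 * j).+1)) => //.
  apply/subsetP => j jS; apply: contraT => jS0.
  by have := H j; rewrite !mem_enum inE jS0 jS => /(_ isT).
by rewrite Sd S0d.
Qed.

End FullMonomial.

(** * An invariant pairing on the exterior powers *)

Section Pairing.
Variables (K : numFieldType) (n : nat).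
Local Notation V := ('cV[K]_n : vectType K).
Local Notation U := (sym2 V).

(** The entry q of an element of S^2 V seen as a symmetric matrix, where the product
    xy is x y^T + y x^T; g then acts as conjugation M -> g M g^T. *)
Definition mcoord (q : 'I_n * 'I_n) : U -> K^o :=
  sym2_ext (fun x y : V => (x q.1 0 * y q.2 0 + x q.2 0 * y q.1 0 : K^o)).

HB.instance Definition _ q := GRing.Linear.copy (mcoord q)
  (sym2_ext (fun x y : V => (x q.1 0 * y q.2 0 + x q.2 0 * y q.1 0 : K^o))).

Lemma mcoord_sprod q (x y : V) :
  mcoord q (sprod x y) = x q.1 0 * y q.2 0 + x q.2 0 * y q.1 0.
Proof.
apply: sym2_ext_sprod => [u v|c u u' v].
  by rewrite addrC; congr (_ + _); rewrite mulrC.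
by rewrite !mxE /GRing.scale /=; ring.
Qed.

Lemma mcoord_act q (g : 'M[K]_n) (u : U) : mcoord q (sym2_map (gl_act g) u)
  = \sum_(r : 'I_n * 'I_n) g q.1 r.1 * g q.2 r.2 * mcoord r u.
Proof.
have H (x y : V) : mcoord q (sprod (g *m x) (g *m y))
    = \sum_(r : 'I_n * 'I_n) g q.1 r.1 * g q.2 r.2 * mcoord r (sprod x y).
  rewrite mcoord_sprod !mxE [X in _ + X]mulrC !big_distrlr -big_split /=.
  rewrite [RHS](eq_bigr (fun r : 'I_n * 'I_n =>
    g q.1 r.1 * x r.1 0 * (g q.2 r.2 * y r.2 0) + g q.1 r.1 * y r.1 0 * (g q.2 r.2 * x r.2 0))).
    rewrite -(pair_bigA _ (fun k l => g q.1 k * x k 0 * (g q.2 l * y l 0)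
       + g q.1 k * y k 0 * (g q.2 l * x l 0))) /=.
    by apply: eq_bigr => k _; rewrite -big_split.
  by move=> r _; rewrite mcoord_sprod; ring.
rewrite [u]sym2_expand !linear_sum /=.
under [RHS]eq_bigr => r _ do rewrite linear_sum mulr_sumr.
rewrite [RHS]exchange_big /=; apply: eq_bigr => p _.
rewrite !linearZ /= sym2_map_sprod !gl_actE H scaler_sumr.
by apply: eq_bigr => r _; rewrite [mcoord r (_ *: _)]linearZ /= scalerAr.
Qed.

(** The trace form on symmetric matrices. *)
Definition symform (u v : U) : K := \sum_q mcoord q u * mcoord q v.

Lemma symformC u v : symform u v = symform v u.
Proof. by apply: eq_bigr => q _; rewrite mulrC. Qed.

Lemma symform_linear v : linear (symform^~ v : U -> K^o).
Proof.
move=> c x y; rewrite /symform scaler_sumr -big_split; apply: eq_bigr => q _.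
by rewrite linearP mulrDl /GRing.scale /= mulrA.
Qed.

Lemma symform_act (g : 'M[K]_n) u v :
  symform (sym2_map (gl_act g) u) v = symform u (sym2_map (gl_act g^T) v).
Proof.
rewrite /symform.
under eq_bigr => q _ do rewrite mcoord_act mulr_suml.
under [RHS]eq_bigr => q _ do rewrite mcoord_act mulr_sumr.
rewrite exchange_big; apply: eq_bigr => r _; apply: eq_bigr => q _.
by rewrite !mxE mulrC mulrA mulrC !mulrA [_ * g _ _]mulrC; ring.
Qed.

(** Both the products monom2 q and the entries of their matrices are counted for the
    two orders of the indices in q, whence the factor 1/4. *)
Lemma symform_repr (l : {linear U -> K^o}) : exists c, forall u, symform u c = l u.
Proof.
pose c := \sum_(q : 'I_n * 'I_n) (4%:R^-1 * l (monom2 K q)) *: monom2 K q; exists c.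
have mm q r : mcoord q (monom2 K r) = (r == q)%:R + (r == (q.2, q.1))%:R.
  case: q r => [i j] [k m]; rewrite mcoord_sprod !mxE !eqxx !andbT -!natrM !mulnb.
  by rewrite !xpair_eqE /= ![k == _]eq_sym ![m == _]eq_sym.
have mc q : mcoord q c = 2%:R^-1 * l (monom2 K q).
  rewrite /c linear_sum (eq_bigr (fun r => (r == q)%:R * (4%:R^-1 * l (monom2 K r))
     + (r == (q.2, q.1))%:R * (4%:R^-1 * l (monom2 K r)))); last first.
    by move=> r _; rewrite linearZ /= mm -mulrDl [RHS]mulrC.
  rewrite big_split (bigD1 q) //= [X in _ + X](bigD1 (q.2, q.1)) //= !eqxx !mul1r.
  rewrite !big1 ?addr0 => [|r /negPf -> |r /negPf ->]; rewrite ?mul0r //.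
  rewrite [monom2 K (q.2, q.1)]sprodC -[sprod _ _]/(monom2 K q).
  by field.
have key x y : symform (sprod x y) c = l (sprod x y).
  pose S := \sum_(q : 'I_n * 'I_n) x q.1 0 * y q.2 0 * l (monom2 K q).
  have lS : l (sprod x y) = S.
    by rewrite sprod_expand linear_sum; apply: eq_bigr => q _; rewrite linearZ.
  have S' : \sum_(q : 'I_n * 'I_n) x q.2 0 * y q.1 0 * l (monom2 K q) = S.
    rewrite (reindex (fun q : 'I_n * 'I_n => (q.2, q.1))) /=.
      by apply: eq_bigr => q _; rewrite [monom2 K (q.2, q.1)]sprodC.
    by exists (fun q => (q.2, q.1)) => [[]|[]].
  rewrite lS /symform (eq_bigr (fun q : 'I_n * 'I_n =>
      2%:R^-1 * (x q.1 0 * y q.2 0 * l (monom2 K q))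
      + 2%:R^-1 * (x q.2 0 * y q.1 0 * l (monom2 K q)))); last first.
    by move=> q _; rewrite mcoord_sprod mc; ring.
  by rewrite big_split -!mulr_sumr S' -/S /=; field.
move=> u; rewrite [u]sym2_expand linear_sum.
have L := linear_expand _ _ (@symform_linear c).
by rewrite L; apply: eq_bigr => p _; rewrite linearZ key.
Qed.

End Pairing.

Section ExtPairing.
Variables (K : fieldType) (U : vectType K) (beta : U -> U -> K).
Hypothesis betaC : forall u v, beta u v = beta v u.
Hypothesis beta_linear : forall v, linear (beta^~ v : U -> K^o).

Section Degree.
Variable d : nat.
Implicit Types (u v : {ffun 'I_d -> U}) (w : ext_pow d U).

(** The bilinear form induced on the exterior power, on pairs of wedges. *)
Definition form_det u v : K^o := \det (\matrix_(a, b) beta (u a) (v b)).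

Lemma form_detC u v : form_det u v = form_det v u.
Proof.
rewrite /form_det -det_tr; congr (\det _); apply/matrixP => a b.
by rewrite !mxE betaC.
Qed.

Lemma form_det_multilinear v : multilinear (fun u => form_det u v).
Proof.
move=> u i c x y; rewrite -[X in _ = _ + X]mul1r; apply: (determinant_multilinear (i0 := i)).
- by apply/rowP => b; rewrite !mxE !ffunE eqxx mul1r; apply: beta_linear.
- by apply/matrixP => a b; rewrite !mxE !ffunE eq_sym (negPf (neq_lift _ _)).
- by apply/matrixP => a b; rewrite !mxE !ffunE eq_sym (negPf (neq_lift _ _)).
Qed.

Lemma form_det_alternating v : alternating (fun u => form_det u v).
Proof.
move=> u i j ij uij; apply: (determinant_alternate ij) => b.
by rewrite !mxE uij.
Qed.

Definition ext_pair_l w v : K^o := ext_ext (fun u => form_det u v) w.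

Lemma ext_pair_l_multilinear w : multilinear (ext_pair_l w).
Proof.
move=> u i c x y; rewrite /ext_pair_l /ext_ext scaler_sumr -big_split; apply: eq_bigr => s _.
set b := [ffun a => basis_vec (val s a)].
by rewrite /= !(form_detC b) form_det_multilinear scalerDr !scalerA [c * _]mulrC.
Qed.

Lemma ext_pair_l_alternating w : alternating (ext_pair_l w).
Proof.
move=> u i j ij uij; rewrite /ext_pair_l /ext_ext big1 // => s _.
set b := [ffun a => basis_vec (val s a)].
by rewrite (form_detC b) (form_det_alternating _ ij uij) scaler0.
Qed.

Definition ext_pair w : ext_pow d U -> K^o := ext_ext (ext_pair_l w).

HB.instance Definition _ w := GRing.Linear.copy (ext_pair w) (ext_ext (ext_pair_l w)).

Lemma ext_pair_wedge w v : ext_pair w (wedge v) = ext_pair_l w v.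
Proof. exact: ext_ext_wedge (ext_pair_l_multilinear w) (ext_pair_l_alternating w). Qed.

Lemma ext_pair_wedge2 u v : ext_pair (wedge u) (wedge v) = form_det u v.
Proof.
rewrite ext_pair_wedge.
exact: ext_ext_wedge (form_det_multilinear v) (form_det_alternating v).
Qed.

Lemma ext_pair_linear_l (v : ext_pow d U) : linear (fun w => ext_pair w v).
Proof.
move=> c w w'; rewrite /ext_pair {1 2 3}/ext_ext scaler_sumr -big_split.
apply: eq_bigr => s _; rewrite /= {1}/ext_pair_l linearP scalerDr !scalerA [c * _]mulrC.
by [].
Qed.

Lemma ext_pair_expand_l w (v : ext_pow d U) :
  ext_pair w v = \sum_s w s *: ext_pair (wedge [ffun a => basis_vec (val s a)]) v.
Proof. by rewrite [w in LHS]ext_expand (linear_expand _ _ (ext_pair_linear_l v)). Qed.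

Lemma ext_pair_expand_r w (v : ext_pow d U) :
  ext_pair w v = \sum_s v s *: ext_pair w (wedge [ffun a => basis_vec (val s a)]).
Proof. by apply: eq_bigr => s _; rewrite ext_pair_wedge. Qed.

Lemma ext_pair_adjoint (f f' : 'End(U)) w (v : ext_pow d U) :
  (forall x y, beta (f x) y = beta x (f' y)) ->
  ext_pair (ext_map d f w) v = ext_pair w (ext_map d f' v).
Proof.
move=> ff'; rewrite (ext_mapE f) (linear_expand _ _ (ext_pair_linear_l v)) [RHS]ext_pair_expand_l.
apply: eq_bigr => s _; congr (_ *: _).
rewrite [LHS]ext_pair_expand_r (ext_mapE f') linear_sum; apply: eq_bigr => t _.
rewrite [RHS]linearZ /= !ext_pair_wedge2; congr (_ *: \det _).
by apply/matrixP => a b; rewrite !mxE !ffunE ff'.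
Qed.

(** Pairing with the wedges of a dual basis gives the coordinates of w. *)
Lemma ext_pair_nondegenerate w :
  (forall l : {linear U -> K^o}, exists c, forall x : U, beta x c = l x) ->
  (forall v : ext_pow d U, ext_pair w v = 0) -> w = 0.
Proof.
move=> repr w0; apply/ffunP => s; rewrite ffunE.
have /fin_all_exists[c cE] (j : 'I_(\dim {: U})) : 
    exists c, forall x : U, beta x c = cd j x.
  exact: (repr (coord (vbasis {: U}) j)).
rewrite -[RHS](w0 (wedge [ffun a => c (val s a)])) ext_pair_wedge.
rewrite [w in LHS]ext_expand sum_ffunE; apply: eq_bigr => t _.
rewrite !ffunE; congr (_ * \det _); apply/matrixP => a b.
by rewrite !mxE !ffunE cE.
Qed.

End Degree.
End ExtPairing.

(** * The dimension of the invariants *)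

Section Dimension.
Variables (K : numFieldType) (n d : nat).
Local Notation inv := (invariants (orthogonal_group K n) (ext_sym2_act K n d)).

Lemma orthogonal_plane_rotation i j t : i != j -> 1 + t ^+ 2 != 0 ->
  orthogonal_group K n (plane_rotation i j t).
Proof.
move=> ij t0; rewrite /orthogonal_group /mkset plane_rotationE // plane_mx_tr //.
by rewrite plane_mxM // -(plane_mx1 K ij); congr plane_mx; field.
Qed.

Lemma orthogonal_coord_reflection i : orthogonal_group K n (coord_reflection K i).
Proof.
by rewrite /orthogonal_group /mkset coord_reflection_tr coord_reflection_sq.
Qed.

Lemma orthogonal_tr g : orthogonal_group K n g -> orthogonal_group K n g^T.
Proof. by rewrite /orthogonal_group /mkset trmxK => /mulmx1C. Qed.

(** The trace monomials of degree d are independent invariants.  Conversely, an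
    invariant that pairs to 0 with all of them defines an invariant functional that
    vanishes on them, so it is 0. *)
Theorem dim_invariants : (0 < n)%N ->
  \dim inv = #|[set S : {set 'I_(uphalf n)} | (\sum_(j in S) (4 * j).+1)%N == d]|.
Proof.
move=> n_gt0; set J := [set S | _].
have [D [xi [xi_sq xi_inj]]] := exterior_model (sym2 'cV[K]_n).
have XC := generic_mx_anti xi_sq.
have /fin_all_exists[F FP] (S : {set 'I_(uphalf n)}) : exists w : ext_sym2 K n d,
    S \in J -> ext_eval xi w = trace_monomial (generic_mx xi) S /\ w \in inv.
  have [SJ|] := boolP (S \in J); last by exists 0.
  have Sd : (\sum_(j in S) (4 * j).+1)%N = d by move: SJ; rewrite inE => /eqP.
  have [w [wE _ winv]] := exists_trace_monomial xi_sq xi_inj Sd.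
  by exists w => _; split=> //; apply/mem_invariants.
apply/eqP; rewrite eqn_leq; apply/andP; split.
  pose pairing (w v : ext_sym2 K n d) : K := ext_pair (@symform K n) w v.
  pose f (w : ext_sym2 K n d) : 'rV[K]_#|J| := \row_i pairing w (F (enum_val i)).
  have fL : linear f.
    by move=> c u v; apply/rowP => i; rewrite !mxE; apply: ext_pair_linear_l.
  pose fl : {linear ext_sym2 K n d -> 'rV[K]_#|J|} :=
    HB.pack f (GRing.isLinear.Build K (ext_sym2 K n d) 'rV[K]_#|J| _ f fL).
  have ker0 : (inv :&: lker (linfun fl))%VS = 0%VS.
    apply/eqP; rewrite -subv0; apply/subvP => w; rewrite memv_cap memv_ker memv0.
    case/andP => /mem_invariants winv; rewrite lfunE => /eqP fw0.
    have pairing_act g v : orthogonal_group K n g ->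
        pairing w (ext_sym2_act K n d g v) = pairing w v.
      move=> gO; rewrite -[w in RHS](winv g^T) ?/pairing; last exact: orthogonal_tr.
      rewrite -[g in LHS]trmxK; apply/esym/ext_pair_adjoint; first exact: symformC.
        exact: symform_linear.
      exact: symform_act.
    apply/eqP/(ext_pair_nondegenerate (@symformC K n) (@symform_linear K n)).
      exact: symform_repr.
    apply: (invariant_functional_eq0 xi_sq xi_inj (h := ext_pair (@symform K n) w)).
    - by move=> i j t v ij t0; apply: pairing_act; apply: orthogonal_plane_rotation.
    - by move=> i v; apply: pairing_act; apply: orthogonal_coord_reflection.
    move=> v S vE Sd; have SJ : S \in J by rewrite inE Sd.
    have -> : v = F S.
      apply/eqP; rewrite -subr_eq0; apply/eqP/xi_inj; rewrite linearB /= vE.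
      by have [-> _] := FP _ SJ; rewrite subrr.
    have := congr1 (fun r : 'rV[K]_#|J| => r 0 (enum_rank_in SJ S)) fw0.
    by rewrite !mxE enum_rankK_in.
  rewrite -(limg_ker_dim (linfun fl) inv) ker0 dimv0 add0n.
  by apply: leq_trans (dimvS (subvf _)) _; rewrite dimvf dim_matrix -[leqRHS]mul1n.
pose X := [tuple F (enum_val i) | i < #|J|].
have XE (i : 'I_#|J|) : X`_i = F (enum_val i) by rewrite (nth_mktuple _ _ i).
have X_free : free X.
  apply/freeP => k kX i.
  pose c (S : {set 'I_(uphalf n)}) := \sum_(i | enum_val i == S) k i : K.
  have cE i' : c (enum_val i') = k i'.
    by rewrite /c (big_pred1 i') // => i''; rewrite /= (inj_eq enum_val_inj).
  rewrite -cE; apply: (trace_monomials_free (X := generic_mx xi) (d := d)).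
  - exact: XC.
  - exact: full_monomial_neq0.
  - transitivity (ext_eval xi (\sum_i k i *: X`_i)); last by rewrite kX linear0.
    rewrite linear_sum (eq_bigl (fun S => S \in J)) => [|S]; last by rewrite inE.
    rewrite big_enum_val; apply: eq_bigr => i' _; rewrite linearZ /= cE XE.
    by have [-> _] := FP _ (enum_valP i').
  by have := enum_valP i; rewrite inE => /eqP.
have /eqP <- : \dim <<X>> == #|J| by have := X_free; rewrite /free size_tuple.
apply/dimvS/span_subvP => w /tnthP[i ->]; rewrite (tnth_nth 0) XE.
by have [_] := FP _ (enum_valP i).
Qed.

End Dimension.

Lemma coef_prod_subsets (m d : nat) :
  (\prod_(k < m) (1 + 'X^((4 * k).+1)) : {poly int})`_d
  = #|[set S : {set 'I_m} | (\sum_(j in S) (4 * j).+1)%N == d]|%:Z.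
Proof.
rewrite (eq_bigr (fun k : 'I_m => 'X^((4 * k).+1) + 1)) => [|k _]; last by rewrite addrC.
rewrite bigA_distr coef_sum -sum1_card -natz natr_sum [RHS]big_mkcond /=.
apply: eq_bigr => S _; rewrite inE -big_mkcond prodrXr coefXn eq_sym.
by case: eqP.
Qed.

Theorem proposition6p1 (R : realType) (n : nat) (hn : (1 <= n)%N) (d : nat) :
  (hilbert_series
     (fun i => invariants (orthogonal_group (complex R) n)
                          (ext_sym2_act (complex R) n i)) d)%:Z
  = (1 + 'X
     + \sum_(2 <= p < n.+1 | ~~ odd p)
         'X^((p * p.+1)./2) *
         (\sum_(a : {ffun 'I_(p./2) -> 'I_(n - p).+1}
               | ((\sum_(j < p./2) a j <= n - p)%N) &&
                 [forall j : 'I_(p./2),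
                    if j.+1 == p./2 then odd (a j) else ~~ odd (a j)])
             'X^(\sum_(j < p./2) 2 * j.+1 * a j)%N)
     + \sum_(3 <= p < n.+1 | odd p)
         'X^((p * p.+1)./2) *
         (\sum_(a : {ffun 'I_(p.-1./2) -> 'I_(n - p).+1}
               | ((\sum_(j < p.-1./2) a j <= n - p)%N) &&
                 [forall j : 'I_(p.-1./2), ~~ odd (a j)])
             'X^(\sum_(j < p.-1./2) 2 * j.+1 * a j)%N)
     : {poly int})`_d.
Proof.
rewrite /hilbert_series dim_invariants // -coef_prod_subsets.
by rewrite -hilbert_polynomial_prod.
Qed.
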